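(* Let $\{b_n : n\ge 1\}$ be the partial quotient sequence of the Engel continued fraction (ECF) expansion, regarded as a sequence of random variables on $(0,1]$ with Lebesgue measure $\mathbf{P}$, and let $\{a_n : n\ge1\}$ be a sequence of positive real numbers satisfying, as $n\to\infty$, $$a_n\to\infty,\qquad \frac{a_n}{\sqrt{n\log n}}\to\infty,\qquad \frac{a_n}{n}\to0.$$ Then the sequence $\left\{\frac{\log b_n-n}{a_n} : n\ge1\right\}$ satisfies a moderate deviation principle with speed $n^{-1}a_n^2$ and good rate function $J(x)=x^2/2$, $x\in\mathbb{R}$.
   Context: Probability space: $\Omega=(0,1]$ with its Borel $\sigma$-algebra and $\mathbf{P}$ = Lebesgue measure. ECF map: $T_E x=\frac{1}{[1/x]}\left(\frac1x-\left[\frac1x\right]\right)$, where $[\cdot]$ is the integer part. Partial quotients: $b_1(x)=[1/x]$ and $b_{n+1}(x)=b_1(T_E^n x)$ for $n\ge1$. For every irrational $x\in(0,1)$ all iterates $T_E^n x$ are irrational numbers in $(0,1)$, so all $b_n(x)$ are defined; thus the $b_n$ are defined $\mathbf{P}$-almost everywhere, take values in the positive integers, and satisfy $b_{n+1}\ge b_n$. A good rate function is a function $J:\mathbb{R}\to[0,\infty]$ that is lower semi-continuous and has compact level sets $\{x: J(x)\le c\}$, $c<\infty$. A moderate deviation principle is formally a large deviation principle with a different speed: $\{X_n\}$ satisfies it with speed $s_n$ (where $s_n\to\infty$) and good rate function $J$ if for every Borel set $\Gamma\subseteq\mathbb{R}$, $$-\inf_{x\in\Gamma^\circ}J(x)\le\liminf_{n\to\infty}\frac1{s_n}\log\mathbf{P}(X_n\in\Gamma)\le\limsup_{n\to\infty}\frac1{s_n}\log\mathbf{P}(X_n\in\Gamma)\le-\inf_{x\in\overline\Gamma}J(x),$$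 where $\Gamma^\circ$ and $\overline\Gamma$ are the interior and closure of $\Gamma$. Conventions: $\log$ is the natural logarithm, $\log 0=-\infty$, $\inf\emptyset=+\infty$. *)

(* Defs.v *)
From HB Require Import structures.
From mathcomp Require Import all_boot all_order all_algebra.
From mathcomp Require Import all_classical all_reals all_analysis.
From mathcomp Require Import measurable_realfun.
Set Implicit Arguments.
Unset Strict Implicit.
Unset Printing Implicit Defensive.
Import Order.TTheory GRing.Theory Num.Theory.
Import numFieldNormedType.Exports.
Local Open Scope classical_set_scope.
Local Open Scope ring_scope.

(* Rate functions J : R -> [0, +oo]; the level sets are indexed by finite c. *)
Definition good_rate_function (R : realType) (J : R -> \bar R) : Prop :=
  [/\ forall x, (0 <= J x)%E,
      lower_semicontinuous J &
      forall c : R, compact [set x | (J x <= c%:E)%E]].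

(* [lne] is the extended logarithm, with lne 0 = -oo, and ereal_inf set0 = +oo.
   The values of X and s at index 0 do not matter: only limits are taken. *)
Definition moderate_deviation_principle d (T : measurableType d) (R : realType)
    (P : probability T R) (X : nat -> {RV P >-> R}) (s : nat -> R)
    (J : R -> \bar R) : Prop :=
  [/\ s n @[n --> \oo] --> +oo,
      good_rate_function J &
      forall Gamma : set R, measurable Gamma ->
        let rate n := (((s n)^-1)%:E * lne (P (X n @^-1` Gamma)))%E in
        [/\ (- ereal_inf (J @` Gamma°) <= limn_einf rate)%E,
            (limn_einf rate <= limn_esup rate)%E &
            (limn_esup rate <= - ereal_inf (J @` closure Gamma))%E]].

(* The probability space (0, 1] with Lebesgue measure, carried by the real line:
   a set A has probability lebesgue_measure (A `&` `]0, 1]). *)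
Section unit_interval_probability.
Variable R : realType.

Definition unit_prob : set (measurableTypeR R) -> \bar R :=
  mrestr (@lebesgue_measure R) (measurable_itv `]0%R, 1%R]).

HB.instance Definition _ := Measure.on unit_prob.

Let unit_prob_setT : unit_prob [set: measurableTypeR R] = 1%E.
Proof.
rewrite /unit_prob /mrestr setTI lebesgue_measure_itv /= lte_fin ltr01.
by rewrite -EFinB subr0.
Qed.

HB.instance Definition _ :=
  Measure_isProbability.Build _ _ R unit_prob unit_prob_setT.

End unit_interval_probability.

Arguments unit_prob R : clear implicits.

(* Total functions: as 0^-1 = 0 and ln 0 = 0 by convention, they also
   take (meaningless) values at the rationals, whose orbits reach 0; this is a
   null set. On irrationals of (0, 1) they are the usual objects. *)
Section engel_continued_fraction.
Variable R : realType.
Implicit Types (x : R) (n : nat) (a : nat -> R).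

Definition ecf_map x : R :=
  ((Num.floor x^-1)%:~R)^-1 * (x^-1 - (Num.floor x^-1)%:~R).

(* b_n(x) for n >= 1, that is b_1(T^(n-1) x) with b_1(y) = [1/y]. *)
Definition ecf_digit n x : int := Num.floor (iter n.-1 ecf_map x)^-1.

Definition ecf_log_deviation a n (x : measurableTypeR R) : R :=
  (ln (ecf_digit n x)%:~R - n%:R) / a n.

Lemma measurable_invr : measurable_fun [set: R] (@GRing.inv R).
Proof.
rewrite -(setvU [set (0 : R)]); apply/measurable_funU => //.
  exact: measurableC.
split; last exact: measurable_fun_set1.
apply: open_continuous_measurable_fun.
  exact/closed_openC/accessible_closed_set1/hausdorff_accessible/norm_hausdorff.
by move=> x; rewrite inE /= => /eqP x0; exact: inv_continuous.
Qed.

Lemma measurable_floorr :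
  measurable_fun [set: R] (fun x => (Num.floor x)%:~R : R).
Proof.
apply: nondecreasing_measurable => // x y xy.
by rewrite ler_int; exact: le_floor.
Qed.

Lemma measurable_floor_invr :
  measurable_fun [set: R] (fun x => (Num.floor x^-1)%:~R : R).
Proof. exact: (measurableT_comp measurable_floorr measurable_invr). Qed.

Lemma measurable_ecf_map : measurable_fun [set: R] ecf_map.
Proof.
apply: measurable_funM.
  exact: (measurableT_comp measurable_invr measurable_floor_invr).
apply: measurable_funB; first exact: measurable_invr.
exact: measurable_floor_invr.
Qed.

Lemma measurable_ecf_digit n :
  measurable_fun [set: R] (fun x => (ecf_digit n x)%:~R : R).
Proof.
apply: (measurableT_comp measurable_floor_invr).
elim: n.-1 => [|m IHm]; first exact: measurable_id.
exact: (measurableT_comp measurable_ecf_map IHm).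
Qed.

Lemma measurable_ecf_log_deviation a n :
  measurable_fun [set: measurableTypeR R] (ecf_log_deviation a n).
Proof.
apply: measurable_funM => //; apply: measurable_funB => //.
exact: (measurableT_comp (@measurable_ln R) (@measurable_ecf_digit n)).
Qed.

HB.instance Definition _ a n := isMeasurableFun.Build _ _ _ _
  (ecf_log_deviation a n) (@measurable_ecf_log_deviation a n).

End engel_continued_fraction.

(* Main.v *)
Require Import Defs.
From mathcomp Require Import all_boot all_order all_algebra.
From mathcomp Require Import all_classical all_reals all_analysis.
From mathcomp Require Import measurable_realfun.
From mathcomp Require Import ring lra.
Import Order.TTheory GRing.Theory Num.Theory.
Import numFieldNormedType.Exports.
Set Implicit Arguments.
Unset Strict Implicit.
Unset Printing Implicit Defensive.
Local Open Scope classical_set_scope.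
Local Open Scope ring_scope.

(** Conditionally on its first n digits, the point T^n x has on (0, 1/b_n) a
density proportional to (1 + r x)^-2, where r lies in [0, 1] and depends only on
those digits. In the coordinate w = 1/(1/x + r) this law is uniform on
(0, 1/(b_n + r)), and the branch of the map on which the next digit is k is
affine in w, sending r to k/(k + r). Hence the digits follow the explicit rule
P(b_(n+1) >= k | past) = (b_n + r)/(k + r) for k >= b_n ([lebesgue_cell],
[prob_digit_lt]).

At r = 0 and at r = 1 this is the same Markov chain P(c' >= k) = c/k, started
from b in the first case and from b + 1, with values shifted by one, in the
second. Stochastic monotonicity squeezes b_n between the two
([ecf_cdf_le_chain], [ecf_cdf_ge_chain]). One step of the chain replaces c by
the integer part of c/U with U uniform, so log c grows roughly by independent
exponential variables of mean 1 and variance 1, which explains both the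
centering n and the rate x^2/2. Two facts make this quantitative with almost no
loss.

- The products of (1 + t/i) over 1 <= i < c, a discrete version of c^t, are
  exact eigenfunctions of the chain with eigenvalue 1/(1 - t), the Laplace
  transform of an exponential variable ([sum_digit_step_eigenfun]). Chernoff's
  method then gives upper bounds for both tails ([upper_tail_laplace],
  [lower_tail_laplace]).
- Both tails dominate (c/j) h^n/n!, where h is the sum of 1/i over c < i <= j
  ([chain_cdf_ge_poisson], [chain_tail_ge_poisson]): since h is close to
  log (j/c), this is nearly the Poisson weight that describes a sum of
  exponential variables. By Stirling's bound it is within a factor of order n
  of the Chernoff bounds.

With a threshold e^(n + y a_n), and t = |y| a_n/n in Chernoff's bounds, all
four bounds become exp (- (y^2/2 + o(1)) a_n^2/n). The growth of
a_n/sqrt(n log n) means that log n = o(a_n^2/n), which absorbs the Stirling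
factor, and a_n/n -> 0 makes the expansion of log (1 + u) to second order exact
at this scale. On the line, these tail asymptotics imply the whole principle: a
closed set away from 0 lies in the union of two half-lines, and a small
interval next to x has the probability of a tail minus an exponentially smaller
one ([mdp_of_tails]). *)

(** * The digit process and a comparison Markov chain *)

Section digit_chain.
Variable R : realFieldType.
Implicit Types (r t : R) (b c j k m n K : nat).

(** The probability that the next digit is k, given that the current one is b
and that the past is summarised by r. *)
Definition digit_step r b k : R := (b%:R + r) / ((k%:R + r) * (k.+1%:R + r)).

(** The probability that n more digits lead from the state (r, b) to a digit
below K. Only intermediate digits below K contribute, because digits do not
decrease; so the sum is finite. *)
Fixpoint ecf_cdf n r b K : R :=
  if n is m.+1 then
    \sum_(b <= k < K) digit_step r b k * ecf_cdf m (k%:R / (k%:R + r)) k K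
  else (b < K)%:R.

(** The same probability for the comparison chain, in which r stays equal to 0
instead of being updated to k/(k + r). *)
Fixpoint chain_cdf n c j : R :=
  if n is m.+1 then \sum_(c <= k < j) digit_step 0 c k * chain_cdf m k j
  else (c < j)%:R.

Lemma digit_step_ge0 r b k : 0 <= r -> 0 <= digit_step r b k.
Proof. by move=> r0; rewrite divr_ge0 ?mulr_ge0 ?addr_ge0. Qed.

Lemma sum_digit_step r b m : (0 < b <= m)%N -> 0 <= r ->
  \sum_(b <= k < m) digit_step r b k = 1 - (b%:R + r) / (m%:R + r).
Proof.
move=> /andP[b0 bm] r0; have pos k : (b <= k)%N -> k%:R + r != 0.
  by move=> bk; rewrite gt_eqF// ltr_pwDl// ltr0n (leq_trans b0).
rewrite (@telescope_sumr_eq _ b m (fun k => - ((b%:R + r) / (k%:R + r)))) //.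
  by rewrite divff ?pos// opprK addrC.
move=> k /andP[bk km]; rewrite /digit_step -addn1 natrD.
have := pos k bk; have := pos k.+1 (leqW bk); rewrite -addn1 natrD => p1 p2.
by field; rewrite p1 p2.
Qed.

(** By Abel summation the difference of the two sides is a combination of the
differences of partial sums, with the nonnegative coefficients v k - v k.+1. *)
Lemma ler_sum_dominance (u w v : nat -> R) b K : (b <= K)%N ->
    (forall m, (b <= m <= K)%N ->
       \sum_(b <= k < m) u k <= \sum_(b <= k < m) w k) ->
    (forall k, (b <= k)%N -> v k.+1 <= v k) -> 0 <= v K ->
  \sum_(b <= k < K) u k * v k <= \sum_(b <= k < K) w k * v k.
Proof.
move=> bK uw vd vK; rewrite -subr_ge0 -sumrB.
pose D m := \sum_(b <= k < m) (w k - u k).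
have D0 m : (b <= m <= K)%N -> 0 <= D m.
  by move=> bmK; rewrite /D sumrB subr_ge0 uw.
apply: (@le_trans _ _ (D K * v K)).
  by rewrite mulr_ge0// D0// bK leqnn.
rewrite -(subnKC bK) in D0 *; elim: (K - b)%N D0 => [|i IH] D0.
  by rewrite /D addn0 !big_geq// mul0r.
have bi : (b <= b + i)%N by rewrite leq_addr.
have {}IH : D (b + i)%N * v (b + i)%N <=
    \sum_(b <= k < b + i) (w k * v k - u k * v k).
  by apply: IH => m /andP[bm mi]; rewrite D0// bm (leq_trans mi)// leq_add2l.
rewrite addnS big_nat_recr//=.
apply: le_trans (_ : D (b + i).+1 * v (b + i)%N <= _).
  by rewrite ler_wpM2l ?vd// D0// addnS leqnn leqW.
by rewrite /D big_nat_recr//= mulrDl -mulrBl lerD2r.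
Qed.

Lemma chain_cdf_ge0 n c j : 0 <= chain_cdf n c j.
Proof.
elim: n c => [|n IH] c //=; apply: sumr_ge0 => k _.
by rewrite mulr_ge0 ?digit_step_ge0.
Qed.

Lemma chain_cdf_geq n c j : (j <= c)%N -> chain_cdf n c j = 0.
Proof. by case: n => [|n] /= jc; [rewrite ltnNge jc|rewrite big_geq]. Qed.

(** The value at c is an average of the value of the previous level at c and of
the value at c.+1, and the former is the larger of the two. *)
Lemma chain_cdf_antitone n c j : (0 < c)%N ->
  chain_cdf n c.+1 j <= chain_cdf n c j.
Proof.
elim: n c => [|n IH] c c0 /=.
  by rewrite ler_nat; case: (ltngtP c.+1 j) => // [/ltnW ->|/ltnW] .
have [jc|cj] := leqP j c.
  by rewrite !big_geq// leqW.
rewrite [leRHS]big_ltn//.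
have cp : 0 < c%:R :> R by rewrite ltr0n.
have E k : digit_step 0 c k = c%:R / c.+1%:R * digit_step 0 c.+1 k.
  by rewrite /digit_step !addr0 [RHS]mulrA divfK// pnatr_eq0.
rewrite [X in _ <= _ + X](_ : _ = c%:R / c.+1%:R *
    \sum_(c.+1 <= k < j) digit_step 0 c.+1 k * chain_cdf n k j); last first.
  by rewrite mulr_sumr; apply: eq_bigr => k _; rewrite E [RHS]mulrA.
set S := (X in X <= _).
have SV : S <= chain_cdf n c j.
  apply: (@le_trans _ _
      (\sum_(c.+1 <= k < j) digit_step 0 c.+1 k * chain_cdf n c j)).
    rewrite /S !big_nat; apply: ler_sum => k /andP[ck kj].
    rewrite ler_wpM2l ?digit_step_ge0//.
    have {kj} : (c <= k)%N by exact: ltnW.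
    move=> /subnKC <-; elim: (k - c)%N => [|i IHi]; first by rewrite addn0.
    by rewrite addnS (le_trans (IH _ _)) // addn_gt0 c0.
  rewrite -mulr_suml sum_digit_step//.
  rewrite -[leRHS]mul1r ler_wpM2r ?chain_cdf_ge0// gerBl !addr0 divr_ge0//.
have -> : digit_step 0 c c = 1 - c%:R / c.+1%:R.
  rewrite /digit_step !addr0 -natr1; field.
  by rewrite natr1 !pnatr_eq0 -!lt0n c0.
have a1 : 0 <= 1 - c%:R / c.+1%:R :> R.
  by rewrite subr_ge0 ler_pdivrMr// mul1r ler_nat.
have avg (a x y : R) : 0 <= 1 - a -> x <= y -> x <= (1 - a) * y + a * x.
  by move=> a0; rewrite -subr_ge0 => /(mulr_ge0 a0); lra.
exact: avg.
Qed.

(** The tail (b + r)/(k + r) of a step increases with r, so replacing r by 0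
makes the digits stochastically smaller. *)
Lemma ecf_cdf_le_chain n r b K : 0 <= r -> r <= 1 -> (0 < b)%N ->
  ecf_cdf n r b K <= chain_cdf n b K.
Proof.
elim: n r b => [|n IH] r b r0 r1 b0 //=.
have [Kb|/ltnW bK] := leqP K b; first by rewrite !big_geq.
apply: (@le_trans _ _ (\sum_(b <= k < K) digit_step r b k * chain_cdf n k K)).
  rewrite !big_nat; apply: ler_sum => k /andP[bk _].
  have k0 := leq_trans b0 bk.
  rewrite ler_wpM2l ?digit_step_ge0// IH// ?divr_ge0 ?addr_ge0//.
  by rewrite ler_pdivrMr ?ltr_pwDl ?ltr0n// mul1r lerDl.
apply: ler_sum_dominance => //; last exact: chain_cdf_ge0.
  move=> m /andP[bm _]; rewrite !sum_digit_step ?b0// lerB// !addr0.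
  have m0 := leq_trans b0 bm.
  rewrite ler_pdivrMr ?ltr0n// mulrAC ler_pdivlMr ?ltr_pwDl ?ltr0n//.
  rewrite mulrDl mulrDr lerD2l mulrC ler_wpM2l// ler_nat//.
by move=> k bk; apply: chain_cdf_antitone; exact: leq_trans b0 bk.
Qed.

(** Replacing r by 1 makes the digits stochastically larger, and the shift by
one turns the tail (b + 1)/(k + 1) into that of the comparison chain. *)
Lemma ecf_cdf_ge_chain n r b K : 0 <= r -> r <= 1 -> (0 < b)%N ->
  chain_cdf n b.+1 K.+1 <= ecf_cdf n r b K.
Proof.
elim: n r b => [|n IH] r b r0 r1 b0 //=.
have [Kb|/ltnW bK] := leqP K b; first by rewrite !big_geq.
apply: (@le_trans _ _
    (\sum_(b <= k < K) digit_step r b k * chain_cdf n k.+1 K.+1)); last first.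
  rewrite !big_nat; apply: ler_sum => k /andP[bk _].
  have k0 := leq_trans b0 bk.
  rewrite ler_wpM2l ?digit_step_ge0// IH// ?divr_ge0 ?addr_ge0//.
  by rewrite ler_pdivrMr ?ltr_pwDl ?ltr0n// mul1r lerDl.
rewrite big_add1/=.
have E k : digit_step 0 b.+1 k.+1 = digit_step 1 b k.
  by rewrite /digit_step !addr0 !natr1.
under eq_bigr do rewrite E.
apply: (@ler_sum_dominance _ _ (fun k => chain_cdf n k.+1 K.+1)) => //;
  last exact: chain_cdf_ge0.
  move=> m /andP[bm _]; rewrite !sum_digit_step ?b0// lerB//.
  have m0 := leq_trans b0 bm.
  rewrite ler_pdivrMr ?ltr_pwDl ?ltr0n// mulrAC ler_pdivlMr ?ltr_pwDl ?ltr0n//.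
  rewrite -subr_ge0.
  rewrite [X in 0 <= X](_ : _ = (1 - r) * (m%:R - b%:R)); last by ring.
  by rewrite mulr_ge0// subr_ge0// ler_nat.
by move=> k bk; exact: chain_cdf_antitone.
Qed.

Definition harmonic_block c j : R := \sum_(c <= k < j) k.+1%:R^-1.

Lemma harmonic_block_ge0 c j : 0 <= harmonic_block c j.
Proof. by apply: sumr_ge0 => k _; rewrite invr_ge0. Qed.

Lemma exprB_le (x y : R) n : 0 <= y -> y <= x ->
  x ^+ n.+1 - y ^+ n.+1 <= n.+1%:R * (x - y) * x ^+ n.
Proof.
move=> y0 yx; rewrite subrXX [leRHS]mulrAC [leRHS]mulrC ler_wpM2l ?subr_ge0//.
rewrite mulr_natl -[in leRHS](card_ord n.+1) -sumr_const.
apply: ler_sum => i _ /=.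
have <- : x ^+ (n - i) * x ^+ i = x ^+ n by rewrite -exprD subnK// -ltnS.
have x0 := le_trans y0 yx.
by rewrite ler_wpM2l ?exprn_ge0 ?lerXn2r.
Qed.

(** A discrete integration of a power: each increment of h ^ n.+1 is at most
n.+1 times the increment of h times the larger of the two values of h ^ n. *)
Lemma harmonic_block_expn_le n c j : (c <= j)%N ->
  harmonic_block c j ^+ n.+1 / (n.+1)`!%:R <=
  \sum_(c <= k < j) k.+1%:R^-1 * (harmonic_block k j ^+ n / n`!%:R).
Proof.
move=> cj; have nf : (0 : R) < n`!%:R by rewrite ltr0n fact_gt0.
pose f k : R := - (harmonic_block k j ^+ n.+1 / (n.+1)`!%:R).
rewrite [leLHS](_ : _ = f j - f c); last first.
  rewrite /f opprK /harmonic_block (big_geq (leqnn j)).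
  by rewrite expr0n/= mul0r oppr0 add0r.
rewrite -(telescope_sumr _ cj) !big_nat; apply: ler_sum => k /andP[ck kj].
rewrite /f opprK addrC -mulrBl.
have E : harmonic_block k j - harmonic_block k.+1 j = k.+1%:R^-1.
  by rewrite /harmonic_block (big_ltn kj) addrK.
have hk : harmonic_block k.+1 j <= harmonic_block k j.
  by rewrite -subr_ge0 E invr_ge0.
have := exprB_le n (harmonic_block_ge0 _ _) hk; rewrite E => H.
rewrite factS natrM ler_pdivrMr ?mulr_gt0// (le_trans H)//.
rewrite le_eqVlt; apply/orP; left; apply/eqP.
by field; rewrite gt_eqF//= nat1r pnatr_eq0.
Qed.

(** The Poisson-like weight is a subsolution of the recursion that the lower
tail of the chain solves, and that the upper tail exceeds by c / j. *)
Lemma chain_poisson_step n c j : (0 < c <= j)%N ->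
  c%:R / j%:R * (harmonic_block c j ^+ n.+1 / (n.+1)`!%:R) <=
  \sum_(c <= k < j)
    digit_step 0 c k * (k%:R / j%:R * (harmonic_block k j ^+ n / n`!%:R)).
Proof.
move=> /andP[c0 cj].
apply: le_trans (ler_wpM2l _ (harmonic_block_expn_le n cj)) _.
  by rewrite divr_ge0.
rewrite mulr_sumr !big_nat; apply: ler_sum => k /andP[ck kj].
have k0 := leq_trans c0 ck.
rewrite le_eqVlt; apply/orP; left; apply/eqP; rewrite /digit_step !addr0.
rewrite -natr1; field.
by rewrite natr1 !pnatr_eq0 -!lt0n k0 fact_gt0 (leq_trans c0 cj).
Qed.

Lemma chain_cdf_ge_poisson n c j : (0 < c < j)%N ->
  c%:R / j%:R * (harmonic_block c j ^+ n / n`!%:R) <= chain_cdf n c j.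
Proof.
elim: n c => [|n IH] c /andP[c0 cj] /=.
  rewrite cj expr0 fact0 divr1 mulr1 ler_pdivrMr ?mul1r ?ler_nat ?ltr0n//.
    exact: ltnW.
  exact: leq_trans cj.
apply: le_trans (chain_poisson_step _ _) _; first by rewrite c0 ltnW.
rewrite !big_nat; apply: ler_sum => k /andP[ck kj].
by rewrite ler_wpM2l ?digit_step_ge0// IH// kj (leq_trans c0 ck).
Qed.

Lemma chain_tailS n c j : (0 < c <= j)%N -> 1 - chain_cdf n.+1 c j =
  c%:R / j%:R + \sum_(c <= k < j) digit_step 0 c k * (1 - chain_cdf n k j).
Proof.
move=> cj /=; under [in RHS]eq_bigr do rewrite mulrBr mulr1.
by rewrite sumrB sum_digit_step// !addr0 addrA addrCA addrN addr0.
Qed.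

(** From c the chain reaches j or more in a single step with probability c / j,
the weight of exponent 0; hence the shift of the index. *)
Lemma chain_tail_ge_poisson n c j : (0 < c <= j)%N ->
  c%:R / j%:R * (harmonic_block c j ^+ n / n`!%:R) <= 1 - chain_cdf n.+1 c j.
Proof.
elim: n c => [|n IH] c cj; rewrite chain_tailS//.
  rewrite expr0 fact0 divr1 mulr1 lerDl big_nat.
  by apply: sumr_ge0 => k /andP[_ kj] /=; rewrite kj subrr mulr0.
apply: le_trans (chain_poisson_step _ cj) _.
rewrite ler_wpDl ?divr_ge0// !big_nat; apply: ler_sum => k /andP[ck kj].
case/andP: cj => c0 cj.
by rewrite ler_wpM2l ?digit_step_ge0// IH// (leq_trans c0 ck) ltnW.
Qed.

(** A discrete analogue of c ^ t. *)
Definition eigenfun t c : R := \prod_(1 <= i < c) (1 + t / i%:R).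

Lemma eigenfun_gt0 t c : -1 < t -> 0 < eigenfun t c.
Proof.
move=> t1; rewrite /eigenfun big_nat; apply: prodr_gt0 => i /andP[i0 _].
have ip : 0 < i%:R :> R by rewrite ltr0n.
have i1 : 1 <= i%:R :> R by rewrite ler1n.
by suff : -1 < t / i%:R by [lra]; rewrite ltr_pdivlMr//; lra.
Qed.

(** For t < 1 the sum over all k >= c is eigenfun t c / (1 - t), so that the
eigenvalue is the Laplace transform at t of an exponential variable of mean 1.
The second term is the contribution of k >= j. *)
Lemma sum_digit_step_eigenfun t c j : t != 1 -> (0 < c <= j)%N ->
  \sum_(c <= k < j) digit_step 0 c k * eigenfun t k =
  (1 - t)^-1 * (eigenfun t c - c%:R / j%:R * eigenfun t j).
Proof.
move=> t1 /andP[c0 cj]; have t1' : 1 - t != 0 by rewrite subr_eq0 eq_sym.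
rewrite (@telescope_sumr_eq _ c j
  (fun k => - ((1 - t)^-1 * (c%:R / k%:R * eigenfun t k)))) //.
  by rewrite opprK divff ?pnatr_eq0 -?lt0n// mul1r addrC -mulrBr.
move=> k /andP[ck kj]; have k0 := leq_trans c0 ck.
rewrite /digit_step !addr0 {2}/eigenfun big_nat_recr//= -/(eigenfun t k).
rewrite -natr1; field.
by rewrite t1' natr1 !pnatr_eq0 -!lt0n k0.
Qed.

Let eigenfun_scale (u p x z e : R) : e != 0 ->
  u * (x - z * e) * (p / e) = u * p * (x / e - z).
Proof. by move=> e0; field. Qed.

(** Chernoff's bound for the lower tail: the eigenfunction at - t decreases, so
it exceeds its value at j as long as the chain stays below j. *)
Lemma chain_cdf_le_eigenfun n t c j : 0 <= t -> t < 1 -> (0 < c)%N ->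
  chain_cdf n c j <= (1 + t) ^- n * (eigenfun (- t) c / eigenfun (- t) j).
Proof.
move=> t0 t1 c0.
have e0 i : 0 < eigenfun (- t) i by rewrite eigenfun_gt0// ltrN2.
have [jc|] := leqP j c.
  rewrite chain_cdf_geq// mulr_ge0 ?invr_ge0 ?exprn_ge0 ?divr_ge0 ?ltW//.
  lra.
elim: n c c0 => [|n IH] c c0 cj /=.
  rewrite expr0 invr1 mul1r cj ler_pdivlMr// mul1r.
  rewrite /eigenfun (big_cat_nat c0 (ltnW cj)) /=.
  rewrite ler_piMr ?(ltW (e0 _))// big_nat.
  apply: prodr_ile1 => i /andP[ci _]; have i0 := leq_trans c0 ci.
  rewrite mulNr subr_ge0 gerBl divr_ge0// andbT.
  by rewrite ler_pdivrMr ?ltr0n// mul1r (le_trans (ltW t1))// ler1n.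
apply: (@le_trans _ _ (\sum_(c <= k < j)
    digit_step 0 c k * eigenfun (- t) k * ((1 + t) ^- n / eigenfun (- t) j))).
  rewrite !big_nat; apply: ler_sum => k /andP[ck kj].
  have k0 := leq_trans c0 ck.
  rewrite -[leRHS]mulrA ler_wpM2l ?digit_step_ge0//.
  by rewrite (le_trans (IH k k0 kj))// mulrA mulrAC mulrC mulrA.
rewrite -mulr_suml sum_digit_step_eigenfun; last 2 first.
- by rewrite lt_eqF//; lra.
- by rewrite c0 ltnW.
rewrite opprK.
rewrite eigenfun_scale ?gt_eqF// exprS invfM ler_wpM2l//.
  by rewrite mulr_ge0 ?invr_ge0 ?exprn_ge0//; lra.
by rewrite gerBl divr_ge0.
Qed.

(** Chernoff's bound for the upper tail: the eigenfunction at t increases. *)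
Lemma chain_tail_le_eigenfun n t c j : 0 <= t -> t < 1 -> (0 < c <= j)%N ->
  1 - chain_cdf n c j <= (1 - t) ^- n * (eigenfun t c / eigenfun t j).
Proof.
move=> t0 t1; have e0 i : 0 < eigenfun t i by rewrite eigenfun_gt0//; lra.
have p0 m : 1 <= (1 - t) ^- m.
  by rewrite invf_ge1 ?exprn_gt0 ?exprn_ile1//; lra.
elim: n c => [|n IH] c /andP[c0 cj].
  rewrite /= expr0 invr1 mul1r; case: ltngtP cj => // [cj|->] _.
    by rewrite subrr divr_ge0// ltW.
  by rewrite subr0 divff// gt_eqF.
rewrite chain_tailS ?c0//.
apply: (@le_trans _ _ (c%:R / j%:R + \sum_(c <= k < j)
    digit_step 0 c k * eigenfun t k * ((1 - t) ^- n / eigenfun t j))).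
  rewrite lerD2l !big_nat; apply: ler_sum => k /andP[ck kj].
  have k0 : (0 < k <= j)%N by rewrite (leq_trans c0 ck) ltnW.
  rewrite -[leRHS]mulrA ler_wpM2l ?digit_step_ge0//.
  by rewrite (le_trans (IH k k0))// mulrA mulrAC mulrC mulrA.
rewrite -mulr_suml sum_digit_step_eigenfun ?c0//; last by rewrite lt_eqF.
rewrite eigenfun_scale ?gt_eqF// -invfM -exprS mulrBr addrCA gerDl subr_le0.
by rewrite ler_peMl// divr_ge0.
Qed.

End digit_chain.

(** * Law of the digits under Lebesgue measure *)

Section affine.
Variable R : realType.

Lemma measurable_affineN (a c : R) : measurable_fun setT
  (fun w : measurableTypeR R => c - a * w : measurableTypeR R).
Proof. by apply: measurable_funB => //; apply: measurable_funM. Qed.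

Lemma lebesgue_measure_affineN (a c : R) (S : set (measurableTypeR R)) :
  0 < a -> measurable S ->
  lebesgue_measure ((fun w : measurableTypeR R => c - a * w) @^-1` S) =
  (a^-1%:E * lebesgue_measure S)%E.
Proof.
move=> a0 mS.
pose f := (fun w : measurableTypeR R => c - a * w : measurableTypeR R).
have mf : measurable_fun setT f := @measurable_affineN a c.
pose m : {measure set _ -> \bar R} := pushforward (@lebesgue_measure R) f.
have a0' : (0 <= a)%R by exact: ltW.
pose m' : {measure set _ -> \bar R} := mscale (NngNum a0') (m mf).
have -> : lebesgue_measure S = m' S.
  apply: lebesgue_measure_unique => // _ [[u v]] _ <-.
  rewrite /m' /mscale /m /pushforward /=.
  rewrite [X in _ = (_ * lebesgue_measure X)%E](_ : _ =
      `[(c - v) / a, (c - u) / a[%classic); last first.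
    apply/seteqP; split => w; rewrite /= !in_itv/=.
      by rewrite ler_pdivrMr// ltr_pdivlMr// /f => /andP[h1 h2]; lra.
    by rewrite ler_pdivrMr// ltr_pdivlMr// /f => /andP[h1 h2]; lra.
  rewrite !lebesgue_measure_itv/= !lte_fin ltr_pM2r ?invr_gt0//.
  rewrite ltrD2l ltrN2; case: ifP => _; last by rewrite mule0.
  by rewrite -!EFinB -EFinM; congr EFin; field; rewrite gt_eqF.
by rewrite /m' /mscale /= muleA -EFinM mulVf ?gt_eqF// mul1e.
Qed.

End affine.

Section ecf.
Variable R : realType.
Implicit Types (r w x : R) (b k n K : nat).

(** The convention that the digit of index 0 is the starting bound b makes the
first step of the recursion an instance of the general one. *)
Definition digit_from b n x : int := if n is 0%N then b%:Z else ecf_digit n x.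

Lemma ecf_digitS n x : ecf_digit n.+2 x = ecf_digit n.+1 (ecf_map x).
Proof. by rewrite /ecf_digit /= -iterS iterSr. Qed.

(** Inverse of the coordinate w = 1 / (1/x + r), in which the conditional law of
the remaining point is uniform. *)
Definition chart r w : R := (w^-1 - r)^-1.

(** Restriction to irrational points removes the endpoints of all branches, so
that the decomposition of a cell along its first digit is an exact equality of
sets. *)
Definition cell n r b K : set (measurableTypeR R) := [set w : R |
  [/\ 0 < w, b%:R + r < w^-1, ~ range (@ratr R) (chart r w) &
      digit_from b n (chart r w) < K%:Z]].

(** The map in the coordinate w, on the piece where the digit is k; the target
coordinate has parameter k / (k + r). *)
Definition branch r k w : R := ((k%:R + r) - (k%:R + r) ^+ 2 * w) / k%:R.

Lemma rational_ecf_map x : (0 < Num.floor x^-1) ->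
  range (@ratr R) (ecf_map x) <-> range (@ratr R) x.
Proof.
rewrite /ecf_map; move: (Num.floor _) => k k0.
have kR : 0 < k%:~R :> R by rewrite ltr0z.
split=> [[q _ qx]|[q _ <-]].
  have xE : x^-1 = k%:~R * (1 + ratr q).
    by rewrite qx mulrDr mulr1 mulrA divff ?gt_eqF// mul1r addrC subrK.
  exists (k%:~R * (1 + q))^-1 => //.
  by rewrite fmorphV rmorphM rmorphD rmorph1 rmorph_int/= -xE invrK.
exists (k%:~R^-1 * (q^-1 - k%:~R)) => //.
by rewrite rmorphM rmorphB !fmorphV/= !rmorph_int.
Qed.

Lemma branch_factor r k w : (0 < k)%N ->
  branch r k w = (k%:R + r) / k%:R * (1 - (k%:R + r) * w).
Proof.
by move=> k0; rewrite /branch; field; rewrite pnatr_eq0 -lt0n.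
Qed.

Lemma branch_mul r k w : 0 <= r -> (0 < k)%N ->
  (k%:R + k%:R / (k%:R + r)) * branch r k w =
  (k.+1%:R + r) * (1 - (k%:R + r) * w).
Proof.
move=> r0 k0; rewrite branch_factor// -natr1; field.
by rewrite pnatr_eq0 -lt0n k0 /= gt_eqF// ltr_wpDr// ltr0n.
Qed.

(** The piece with digit k is mapped onto the whole starting interval of the
state (k / (k + r), k). *)
Lemma branch_itv r k w : 0 <= r -> (0 < k)%N ->
  [/\ 0 < w, k%:R + r < w^-1 & w^-1 < k.+1%:R + r] <->
  (0 < branch r k w /\ k%:R + k%:R / (k%:R + r) < (branch r k w)^-1).
Proof.
move=> r0 k0; have kR : 0 < k%:R :> R by rewrite ltr0n.
have kr : 0 < k%:R + r by lra.
have kS : 0 < k.+1%:R + r by rewrite -natr1; lra.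
have bm := branch_mul w r0 k0.
have bf : (0 < branch r k w) = ((k%:R + r) * w < 1).
  by rewrite branch_factor// pmulr_rgt0 ?divr_gt0// subr_gt0.
have bi : ((k%:R + k%:R / (k%:R + r)) * branch r k w < 1) =
    (1 < (k.+1%:R + r) * w).
  have E : (k.+1%:R + r) * (1 - (k%:R + r) * w) - 1 =
      (k%:R + r) * (1 - (k.+1%:R + r) * w) by rewrite -natr1; ring.
  by rewrite bm -[LHS]subr_lt0 E pmulr_rlt0// subr_lt0.
split=> [[w0 h1 h2]|[v0 hv]].
  have v0 : 0 < branch r k w by rewrite bf -ltr_pdivlMr// div1r.
  by split => //; rewrite -[ltRHS]div1r ltr_pdivlMr// bi -ltr_pdivrMr// div1r.
have h2 : 1 < (k.+1%:R + r) * w by rewrite -bi -ltr_pdivlMr// div1r.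
have w0 : 0 < w by rewrite -(pmulr_rgt0 _ kS) (lt_trans ltr01).
by split => //; rewrite -[w^-1]div1r ?ltr_pdivlMr ?ltr_pdivrMr// -bf.
Qed.

Lemma branch_floor r k w : k%:R + r < w^-1 -> w^-1 < k.+1%:R + r ->
  Num.floor (chart r w)^-1 = k%:Z.
Proof.
move=> h1 h2; apply: floor_def; rewrite /chart invrK intrD -!pmulrn.
by rewrite -natr1 in h2; lra.
Qed.

(** The branch is conjugate to the continued fraction map. *)
Lemma branch_chart r k w : 0 <= r -> (0 < k)%N -> 0 < w ->
    k%:R + r < w^-1 -> w^-1 < k.+1%:R + r ->
  chart (k%:R / (k%:R + r)) (branch r k w) = ecf_map (chart r w).
Proof.
move=> r0 k0 w0 h1 h2; have kR : 0 < k%:R :> R by rewrite ltr0n.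
have kr : 0 < k%:R + r by lra.
have v0 : 0 < 1 - (k%:R + r) * w.
  by rewrite subr_gt0 -ltr_pdivlMr// div1r.
rewrite /ecf_map (branch_floor h1 h2) -pmulrn {1}/chart branch_factor//.
rewrite /chart invrK.
apply/eqP; rewrite -(inj_eq invr_inj) invrK; apply/eqP; field.
rewrite (_ : 1 + _ + _ = 1 - (k%:R + r) * w); last by ring.
by rewrite !gt_eqF.
Qed.

Lemma cell_branch n r b K w : 0 <= r -> (0 < b)%N -> cell n.+1 r b K w ->
  exists2 k, (b <= k)%N & cell n (k%:R / (k%:R + r)) k K (branch r k w).
Proof.
move=> r0 b0 [w0 bw irr dK].
have : b%:Z <= Num.floor (chart r w)^-1.
  by rewrite floor_ge_int /chart invrK -pmulrn; lra.
case E : (Num.floor (chart r w)^-1) => [k|//]; rewrite lez_nat => bk.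
have k0 := leq_trans b0 bk.
have [h1 h2] : k%:R + r < w^-1 /\ w^-1 < k.+1%:R + r.
  have /andP[] := floor_itv (chart r w)^-1.
  rewrite E intrD -!pmulrn /chart invrK natr1 => h1 h2; split; last lra.
  rewrite lt_neqAle; apply/andP; split; last by lra.
  apply/eqP => kw; apply: irr; exists k%:R^-1 => //.
  by rewrite fmorphV rmorph_nat /chart -kw addrK.
have [v0 hv] := (branch_itv w r0 k0).1 (And3 w0 h1 h2).
exists k => //; split => //; rewrite branch_chart//.
  by rewrite rational_ecf_map// E ltz_nat.
by case: n dK => [|n] /=; rewrite ?ecf_digitS// /ecf_digit/= E.
Qed.

Lemma branch_cell n r b K k w : 0 <= r -> (0 < b <= k)%N ->
  cell n (k%:R / (k%:R + r)) k K (branch r k w) -> cell n.+1 r b K w.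
Proof.
move=> r0 /andP[b0 bk] [v0 hv]; have k0 := leq_trans b0 bk.
have [w0 h1 h2] := (branch_itv w r0 k0).2 (conj v0 hv).
have E := branch_floor h1 h2.
rewrite branch_chart// rational_ecf_map ?E ?ltz_nat// => irr dK.
split => //; first by rewrite (le_lt_trans _ h1)// lerD2r ler_nat.
by case: n dK => [|n] /=; rewrite ?ecf_digitS// /ecf_digit/= E.
Qed.

Lemma cell_lt n r b K w : 0 <= r -> (0 < b)%N -> cell n r b K w -> (b < K)%N.
Proof.
elim: n r b w => [|n IH] r b w r0 b0; first by case=> _ _ _ /=; rewrite ltz_nat.
move=> /(cell_branch r0 b0)[k bk] kK; apply: (leq_ltn_trans bk).
apply: IH kK; last exact: leq_trans bk.
by rewrite divr_ge0// addr_ge0.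
Qed.

Lemma measurable_chart r : measurable_fun setT
  (chart r : measurableTypeR R -> measurableTypeR R).
Proof.
apply: (measurableT_comp (@measurable_invr R)).
by apply: measurable_funB => //; exact: measurable_invr.
Qed.

Lemma measurable_rational :
  measurable (range (@ratr R) : set (measurableTypeR R)).
Proof.
apply: countable_measurable; first exact: measurable_set1.
apply: sub_countable (card_image_le _ _) _; exact: countableP.
Qed.

Lemma measurable_ecf_digit_lt n K :
  measurable ([set x | ecf_digit n x < K%:Z] : set (measurableTypeR R)).
Proof.
have -> : [set x : R | ecf_digit n x < K%:Z] =
    (fun x => (ecf_digit n x)%:~R : R) @^-1` `]-oo, K%:R[.
  by apply/seteqP; split => w; rewrite /= in_itv/= [K%:R]pmulrn ltr_int.
rewrite -[X in measurable X]setTI; exact: measurable_ecf_digit.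
Qed.

Lemma measurable_cell n r b K : measurable (cell n r b K).
Proof.
rewrite (_ : cell n r b K = [set` `]0, +oo[] `&` [set w | b%:R + r < w^-1] `&`
  (chart r @^-1` (~` range ratr)) `&`
  (chart r @^-1` [set x | digit_from b n x < K%:Z])); last first.
  apply/seteqP; split => w.
    by case=> w0 bw irr dK; rewrite /= in_itv/= w0.
  by rewrite /= in_itv/= andbT => -[[[? ?] ?] ?].
apply: measurableI; [apply: measurableI; [apply: measurableI|]|] => //.
- rewrite -[X in measurable X]setTI.
  have -> : [set w : R | b%:R + r < w^-1] = GRing.inv @^-1` `]b%:R + r, +oo[.
    by apply/seteqP; split => w; rewrite /= in_itv/= andbT.
  exact: measurable_invr.
- rewrite -[X in measurable X]setTI; apply: measurable_chart => //.
  by apply: measurableC; exact: measurable_rational.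
- rewrite -[X in measurable X]setTI; apply: measurable_chart => //.
  case: n => [|n] /=.
    by case: (_ < _) => //; rewrite ?set_true ?set_false.
  exact: measurable_ecf_digit_lt.
Qed.

(** A cell is the disjoint union, over its first digit k, of affine preimages of
cells; the slope of the branch turns the lengths 1 / (b + r) and
1 / (k + k / (k + r)) into the transition probability. *)
Lemma lebesgue_cell n r b K : 0 <= r -> (0 < b)%N ->
  lebesgue_measure (cell n r b K) = (ecf_cdf n r b K / (b%:R + r))%:E.
Proof.
elim: n r b => [|n IH] r b r0 b0.
  have br : 0 < b%:R + r by rewrite ltr_pwDl// ltr0n.
  rewrite /=; have [bK|Kb] := ltnP b K; last first.
    rewrite (_ : cell _ _ _ _ = set0) ?measure0 ?mul0r//.
    by apply/seteqP; split => // w /(cell_lt r0 b0); rewrite ltnNge Kb.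
  pose N := chart r @^-1` range (@ratr R).
  have mN : measurable (N : set (measurableTypeR R)).
    rewrite -[X in measurable X]setTI; apply: measurable_chart => //.
    exact: measurable_rational.
  have N0 : lebesgue_measure N = 0.
    apply: countable_lebesgue_measure0.
    have -> : N = (fun q => ((ratr q)^-1 + r)^-1) @` [set: rat].
      apply/seteqP; split=> [w [q _ qw]|_ [q _ <-]]; exists q => //.
        by rewrite qw /chart invrK subrK invrK.
      by rewrite /chart invrK addrK invrK.
    by apply: sub_countable (card_image_le _ _) _; exact: countableP.
  rewrite (_ : cell _ _ _ _ = [set` `]0, (b%:R + r)^-1[] `\` N); last first.
    apply/seteqP; split => w.
      case=> w0 bw irr _; split; last by [].
      by rewrite /= in_itv/= w0 -[ltLHS]invrK ltf_pV2// posrE invr_gt0.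
    case; rewrite /= in_itv/= => /andP[w0 wb] irr; split => //=.
    by rewrite -[ltLHS]invrK ltf_pV2// posrE invr_gt0.
  have I0 : (lebesgue_measure (`]0%R, (b%:R + r)^-1%R[%classic : set R) =
      (b%:R + r)^-1%:E)%E.
    by rewrite lebesgue_measure_itv/= lte_fin invr_gt0 br sube0.
  rewrite measureD//=; last by rewrite [ltLHS]I0 ltry.
  rewrite [X in (X - _)%E]I0 (subset_measure0 _ _ _ N0)//.
    by rewrite sube0 mul1r.
  exact: measurableI.
pose F i := branch r (i + b) @^-1`
  cell n ((i + b)%:R / ((i + b)%:R + r)) (i + b) K.
have kb0 i : (0 < i + b)%N by rewrite addn_gt0 b0 orbT.
have kr i : 0 < (i + b)%:R + r by rewrite ltr_pwDl// ltr0n.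
have FE i : F i = (fun w : measurableTypeR R => ((i + b)%:R + r) / (i + b)%:R -
    ((i + b)%:R + r) ^+ 2 / (i + b)%:R * w) @^-1`
  cell n ((i + b)%:R / ((i + b)%:R + r)) (i + b) K.
  have brE w : branch r (i + b) w = ((i + b)%:R + r) / (i + b)%:R -
      ((i + b)%:R + r) ^+ 2 / (i + b)%:R * w by rewrite /branch mulrBl mulrAC.
  by apply/seteqP; split => w; rewrite /F /preimage /mkset brE.
have a0 i : 0 < ((i + b)%:R + r) ^+ 2 / (i + b)%:R.
  by rewrite divr_gt0 ?exprn_gt0// ltr0n.
have mF i : measurable (F i : set (measurableTypeR R)).
  rewrite FE -[X in measurable X]setTI.
  by apply: measurable_affineN => //; exact: measurable_cell.
have muF i : lebesgue_measure (F i) =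
    (digit_step r b (i + b) *
      ecf_cdf n ((i + b)%:R / ((i + b)%:R + r)) (i + b) K / (b%:R + r))%:E.
  rewrite FE lebesgue_measure_affineN//; last exact: measurable_cell.
  rewrite IH//; last by rewrite divr_ge0// ltW.
  rewrite -EFinM; congr EFin; rewrite /digit_step -natr1.
  have alg (k y B : R) : 0 < k -> 0 < B -> ((k + r) ^+ 2 / k)^-1 *
      (y / (k + k / (k + r))) = B / ((k + r) * (k + 1 + r)) * y / B.
    move=> k0 B0; have kr0 : 0 < k + r by lra.
    have : 0 < k * (k + r) + k by rewrite addr_gt0// mulr_gt0.
    by move=> ?; field; rewrite !gt_eqF//; lra.
  by apply: alg; [rewrite ltr0n|rewrite ltr_pwDl// ltr0n].
(* digits k >= K are excluded by cell_lt, so finitely many pieces remain *)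
have -> : cell n.+1 r b K = \big[setU/set0]_(i < K - b) F i.
  apply/seteqP; split => w.
    move=> /(cell_branch r0 b0)[k bk kw].
    have kK : (k < K)%N.
      by apply: cell_lt kw; rewrite ?divr_ge0 ?addr_ge0// (leq_trans b0).
    rewrite -bigcup_mkord; exists (k - b)%N.
      by rewrite /= ltn_sub2r// (leq_ltn_trans bk).
    by rewrite /F subnK.
  rewrite -bigcup_mkord => -[i /= iK] /branch_cell; apply => //.
  by rewrite b0 leq_addl.
rewrite (measure_bigsetU _ mF); last first.
  apply/trivIsetP => i j _ _ ij; apply/seteqP; split => // w [].
  have floorF l : F l w -> Num.floor (chart r w)^-1 = (l + b)%:Z.
    move=> [v0 hv _ _].
    have [w0 h1 h2] := (branch_itv w r0 (kb0 l)).2 (conj v0 hv).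
    exact: branch_floor.
  move=> /floorF E /floorF; rewrite E => -[] /eqP.
  by rewrite eqn_add2r (negPf ij).
transitivity (\sum_(i < K - b) (digit_step r b (i + b) *
    ecf_cdf n ((i + b)%:R / ((i + b)%:R + r)) (i + b) K / (b%:R + r))%:E)%E.
  by apply: eq_bigr => i _; exact: muF.
rewrite sumEFin -mulr_suml; congr (_ / _)%:E.
by rewrite /= -[in RHS](add0n b) big_addn big_mkord.
Qed.

Lemma eq_unit_prob_irrational (A B : set (measurableTypeR R)) :
    measurable A -> measurable B ->
    (forall x : R, 0 < x < 1 -> ~ range (@ratr R) x -> A x <-> B x) ->
  unit_prob R A = unit_prob R B.
Proof.
move=> mA mB AB.
suff : forall A B : set (measurableTypeR R), measurable A -> measurable B ->
    (forall x : R, 0 < x < 1 -> ~ range (@ratr R) x -> A x -> B x) ->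
    (unit_prob R A <= unit_prob R B)%E.
  by move=> H; apply/eqP; rewrite eq_le !H// => x x01 xQ; case: (AB x x01 xQ).
move=> {mA mB AB}A {}B mA mB AB; rewrite /unit_prob /mrestr.
rewrite -(@measureU0 _ _ _ lebesgue_measure (B `&` `]0, 1]) (range ratr)) //.
- apply: le_measure; rewrite ?inE//; last move=> x [Ax].
    exact: measurableI.
    by apply: measurableU; [exact: measurableI|exact: measurable_rational].
  rewrite /= in_itv/= => x01.
  have [xQ|xQ] := pselect (range (@ratr R) x); [by right|left].
  split => //; apply: AB => //.
  case/andP: x01 => -> x1 /=; rewrite lt_neqAle x1 andbT.
  by apply/eqP => xE; apply: xQ; exists 1 => //; rewrite rmorph1.
- exact: measurableI.
- exact: measurable_rational.
- exact: lebesgue_measure_rat.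
Qed.

Lemma cell_initial n K x : 0 < x < 1 -> ~ range (@ratr R) x ->
  (ecf_digit n.+1 x < K%:Z) <-> cell n.+1 0 1 K x.
Proof.
move=> /andP[x0 x1] xQ; have cx : chart 0 x = x by rewrite /chart subr0 invrK.
split=> [dK|[_ _ _]]; last by rewrite cx.
by split; rewrite ?cx// addr0 invf_gt1.
Qed.

Lemma ecf_digit_gt0 n x : 0 < x < 1 -> ~ range (@ratr R) x ->
  0 < ecf_digit n.+1 x.
Proof.
move=> x01 xQ; rewrite ltNge; apply/negP => d0.
have : cell n.+1 0 1 1 x by apply/cell_initial => //; rewrite (le_lt_trans d0).
by move=> /(cell_lt (lexx 0) (ltn0Sn 0)).
Qed.

Lemma prob_digit_lt n K :
  unit_prob R [set x | ecf_digit n.+1 x < K%:Z] = (ecf_cdf n.+1 0 1 K)%:E.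
Proof.
rewrite (@eq_unit_prob_irrational _ (cell n.+1 0 1 K)).
- rewrite /unit_prob /mrestr (_ : _ `&` _ = cell n.+1 0 1 K).
    by rewrite lebesgue_cell// addr0 divr1.
  apply/seteqP; split => [x []//|x cx]; split => //.
  case: cx => x0; rewrite addr0 invf_gt1// => x1 _ _.
  by rewrite /= in_itv/= x0 ltW.
- exact: measurable_ecf_digit_lt.
- exact: measurable_cell.
- exact: cell_initial.
Qed.
End ecf.

Section probability.
Variable R : realType.

(** A threshold e ^ T on integers amounts to the threshold given by its
ceiling. *)
Definition log_digit_cdf n (T : R) : R :=
  ecf_cdf n 0 1 `|Num.ceil (expR T)|%N.

Lemma prob_log_digit_lt n (T : R) :
  unit_prob R [set x | ln (ecf_digit n.+1 x)%:~R < T] =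
  (log_digit_cdf n.+1 T)%:E.
Proof.
rewrite -prob_digit_lt; apply: eq_unit_prob_irrational.
- rewrite (_ : mkset _ =
      (fun x => ln (ecf_digit n.+1 x)%:~R : R) @^-1` `]-oo, T[).
    rewrite -[X in measurable X]setTI.
    have := measurableT_comp (@measurable_ln R) (@measurable_ecf_digit R n.+1).
    by apply.
  by apply/seteqP; split => x; rewrite /= in_itv.
- exact: measurable_ecf_digit_lt.
- move=> x x01 xQ /=; have d0 := ecf_digit_gt0 n x01 xQ.
  rewrite gez0_abs ?ceil_ge0 ?(lt_trans _ (expR_gt0 T))// ?ltrN10//.
  rewrite ceil_gt_int -ltr_expR lnK// ?posrE ?ltr0z//.
Qed.

Lemma prob_deviation_lt (a : nat -> R) n y : (0 < n)%N -> 0 < a n ->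
  unit_prob R (ecf_log_deviation a n @^-1` `]-oo, y[) =
  (log_digit_cdf n (n%:R + y * a n))%:E.
Proof.
case: n => // n _ an; rewrite -prob_log_digit_lt; congr (unit_prob R _).
apply/seteqP; split => x; rewrite /= in_itv/= /ecf_log_deviation.
  by rewrite ltr_pdivrMr//; lra.
by rewrite ltr_pdivrMr//; lra.
Qed.
End probability.

(** * Explicit bounds on the two tails *)

Section bounds.
Variable R : realType.
Implicit Types (x t T : R) (n k K : nat).

(** Bernoulli's inequality (1 + x) ^ t <= 1 + t x, by convexity of the
exponential between ln (1 + x) and 0. *)
Lemma expR_bernoulli t x : 0 <= t -> t <= 1 -> -1 < x ->
  expR (t * ln (1 + x)) <= 1 + t * x.
Proof.
move=> t0 t1 x1; have := convex_expR (Itv01 t0 t1) (ln (1 + x)) 0.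
rewrite !convRE/= mulr0 addr0 expR0 mulr1 lnK ?posrE; last lra.
by rewrite /unstable.onem; lra.
Qed.

Lemma eigenfun_ge t K : 0 <= t -> t <= 1 ->
  expR (t * ln K.+1%:R) <= eigenfun t K.+1.
Proof.
move=> t0 t1; elim: K => [|K IH].
  by rewrite ln1 mulr0 expR0 /eigenfun big_geq.
rewrite /eigenfun big_nat_recr//= -/(eigenfun t K.+1).
have K0 : 0 < K.+1%:R :> R by rewrite ltr0n.
have -> : K.+2%:R = K.+1%:R * (1 + K.+1%:R^-1) :> R.
  by rewrite mulrDr mulr1 divff ?gt_eqF// natr1.
rewrite lnM ?posrE ?addr_gt0 ?invr_gt0// mulrDr expRD.
apply: ler_pM; rewrite ?expR_ge0// expR_bernoulli//.
by rewrite (@lt_trans _ _ 0)// ?invr_gt0//; lra.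
Qed.

(** The factor of index 1 is 1 - t; it is kept apart because 1 - 1/i vanishes
at i = 1. *)
Lemma eigenfunN_ge t K : 0 <= t -> t <= 1 ->
  (1 - t) * expR (- t * ln K.+1%:R) <= eigenfun (- t) K.+2.
Proof.
move=> t0 t1; elim: K => [|K IH].
  by rewrite ln1 mulr0 expR0 /eigenfun big_nat1 divr1 mulr1.
rewrite /eigenfun big_nat_recr//= -/(eigenfun (- t) K.+2).
have K0 : 0 < K.+2%:R :> R by rewrite ltr0n.
have K2 : K.+2%:R^-1 < 1 :> R by rewrite invf_lt1// ltr1n.
have E : K.+1%:R = K.+2%:R * (1 - K.+2%:R^-1) :> R.
  by rewrite mulrBr mulr1 divff ?gt_eqF// -[in RHS]natr1 addrK.
have {E} -> : - t * ln K.+2%:R =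
    - t * ln K.+1%:R + t * ln (1 - K.+2%:R^-1) :> R.
  by rewrite E lnM ?posrE ?subr_gt0//; ring.
rewrite expRD mulrA; apply: ler_pM; rewrite ?mulr_ge0 ?expR_ge0 ?subr_ge0//.
by rewrite mulNr -mulrN expR_bernoulli// ltrN2.
Qed.

Lemma harmonic_block_ge_ln c j : (c <= j)%N ->
  ln (j.+1%:R / c.+1%:R) <= harmonic_block R c j.
Proof.
move=> /subnKC <-; elim: (j - c)%N => [|i IH].
  by rewrite addn0 divff ?pnatr_eq0// ln1 /harmonic_block big_geq.
rewrite addnS /harmonic_block big_nat_recr ?leq_addr//=.
rewrite -/(harmonic_block R c (c + i)).
set m := (c + i)%N in IH *.
have m0 : 0 < m.+1%:R :> R by rewrite ltr0n.
have -> : m.+2%:R / c.+1%:R = m.+1%:R / c.+1%:R * (1 + m.+1%:R^-1) :> R.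
  rewrite -natr1; field.
  by rewrite !nat1r !pnatr_eq0.
rewrite lnM ?posrE ?divr_gt0 ?addr_gt0 ?invr_gt0 ?ltr0n// lerD//.
by rewrite le_ln1Dx// (@lt_trans _ _ 0)// ?invr_gt0//; lra.
Qed.

(** Stirling's upper bound n! <= e n (n / e) ^ n. *)
Lemma ln_fact_le n :
  ln (n.+1)`!%:R <= 1 + ln n.+1%:R + n.+1%:R * ln n.+1%:R - n.+1%:R :> R.
Proof.
elim: n => [|n IH]; first by rewrite factS fact0 muln1 ln1 mulr0; lra.
rewrite factS natrM lnM ?posrE ?ltr0n ?fact_gt0//.
have n1 : 0 < n.+1%:R :> R by rewrite ltr0n.
have n2 : 0 < n.+2%:R :> R by rewrite ltr0n.
have : ln (n.+1%:R / n.+2%:R) <= - n.+2%:R^-1 :> R.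
  have -> : n.+1%:R / n.+2%:R = 1 - n.+2%:R^-1 :> R.
    rewrite -[n.+2%:R]natr1 -[n.+1%:R]natr1; field.
    by rewrite gt_eqF//; have := ler0n R n; lra.
  by rewrite le_ln1Dx// ltrN2 invf_lt1// ltr1n.
rewrite ln_div ?posrE// -(ler_pM2l n2) mulrN divff ?gt_eqF//.
have : n.+2%:R = n.+1%:R + 1 :> R by rewrite natr1.
lra.
Qed.

Section threshold.
Variables (n : nat) (T : R).
Let K := `|Num.ceil (expR T)|%N.
Let F := log_digit_cdf n T.

Let KE : K%:Z = Num.ceil (expR T).
Proof. by rewrite gez0_abs// ltW// ceil_gt0 expR_gt0. Qed.

Let K_ge : expR T <= K%:R.
Proof. by rewrite pmulrn KE ceil_ge. Qed.

Let K_lt : K%:R - 1 < expR T.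
Proof.
by have /andP[+ _] := ceil_itv (expR T); rewrite intrB -KE -pmulrn.
Qed.

Let K_gt0 : (0 < K)%N.
Proof. by rewrite -(ltr0n R) (lt_le_trans _ K_ge)// expR_gt0. Qed.

Lemma upper_tail_laplace t : 0 <= t -> t < 1 ->
  1 - F <= 2 * (1 - t) ^- n * expR (- t * T).
Proof.
move=> t0 t1.
have e0 : 0 < eigenfun t K.+1 by rewrite eigenfun_gt0//; lra.
apply: (@le_trans _ _ (1 - chain_cdf R n 2 K.+1)).
  by rewrite lerB// ecf_cdf_ge_chain.
apply: le_trans (chain_tail_le_eigenfun _ t0 t1 _) _ => //.
rewrite [leRHS]mulrAC [leRHS]mulrC ler_wpM2l//.
  by rewrite invr_ge0 exprn_ge0//; lra.
rewrite ler_pdivrMr//.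
have e2 : eigenfun t 2 <= 2 by rewrite /eigenfun big_nat1 divr1; lra.
apply: (le_trans e2); rewrite -mulrA ler_peMr// mulNr expRN.
rewrite mulrC ler_pdivlMr ?expR_gt0// mul1r.
apply: le_trans (eigenfun_ge K t0 (ltW t1)); rewrite ler_expR ler_wpM2l//.
rewrite -[leLHS]expRK ler_ln ?posrE ?expR_gt0 ?ltr0n// (le_trans K_ge)//.
by rewrite ler_nat.
Qed.

Lemma lower_tail_laplace t : 0 <= t -> t < 1 ->
  F <= (1 - t)^-1 * (1 + t) ^- n * expR (t * T).
Proof.
move=> t0 t1.
apply: (@le_trans _ _ (chain_cdf R n 1 K)); first by rewrite ecf_cdf_le_chain.
have [K1|K1] := leqP K 1.
  by rewrite chain_cdf_geq// !mulr_ge0 ?invr_ge0 ?exprn_ge0 ?expR_ge0//; lra.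
apply: le_trans (chain_cdf_le_eigenfun _ _ t0 t1 _) _ => //.
rewrite [leRHS]mulrAC [leRHS]mulrC ler_wpM2l//.
  by rewrite invr_ge0 exprn_ge0//; lra.
rewrite {1}/eigenfun big_geq// div1r -[leRHS]invrK lef_pV2; last 2 first.
- by rewrite posrE eigenfun_gt0//; lra.
- by rewrite posrE invr_gt0 mulr_gt0 ?expR_gt0// invr_gt0 subr_gt0.
rewrite invfM invrK -expRN -mulNr.
have KE2 : K = K.-2.+2 by case: K K1 => [|[]].
rewrite KE2; apply: le_trans (eigenfunN_ge _ t0 (ltW t1)).
rewrite ler_wpM2l ?subr_ge0 ?(ltW t1)// ler_expR !mulNr lerN2 ler_wpM2l//.
rewrite -[leRHS]expRK ler_ln ?posrE ?expR_gt0 ?ltr0n//.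
by rewrite (le_trans _ (ltW K_lt))// [in leRHS]KE2 -[K.-2.+2%:R]natr1 addrK.
Qed.

Hypothesis T3 : ln 3 <= T.

Let expT3 : 3 <= expR T.
Proof. by rewrite -[leLHS]lnK ?posrE// ler_expR. Qed.

Let ln_thirdT (c j : nat) : (0 < c <= 3)%N -> K%:R <= j%:R :> R ->
  T - ln 3 <= ln (j%:R / c%:R).
Proof.
move=> /andP[c0 c3] Kj; have j0 : 0 < j%:R :> R.
  by rewrite (lt_le_trans _ Kj)// ltr0n.
rewrite ln_div ?posrE// ?ltr0n// lerB//.
  rewrite -[leLHS]expRK ler_ln ?posrE ?expR_gt0//.
  exact: le_trans Kj.
by rewrite ler_ln ?posrE ?ltr0n// ler_nat.
Qed.

Let u0 : 0 <= T - ln 3. Proof. by rewrite subr_ge0. Qed.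

(** The shift by ln 3 comes from the comparison chain started at 2, whose
harmonic block has endpoints K + 2 and 3. *)
Lemma lower_tail_ge_weight :
  (4 * expR T)^-1 * ((T - ln 3) ^+ n / n`!%:R) <= F.
Proof.
have K2 : (1 < K)%N.
  by rewrite -(ltr_nat R) (lt_le_trans _ K_ge)//; have := expT3; lra.
apply: (@le_trans _ _ (chain_cdf R n 2 K.+1)); last by rewrite ecf_cdf_ge_chain.
apply: le_trans; last by apply: chain_cdf_ge_poisson; rewrite ltnS.
apply: ler_pM; rewrite ?invr_ge0 ?mulr_ge0 ?divr_ge0 ?exprn_ge0 ?expR_ge0//.
  rewrite -[leRHS]invrK.
  rewrite lef_pV2 ?posrE ?invr_gt0 ?divr_gt0 ?mulr_gt0 ?expR_gt0//.
  by rewrite invf_div -natr1; move: K_lt expT3; lra.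
rewrite ler_wpM2r ?invr_ge0// lerXn2r ?nnegrE ?harmonic_block_ge0//.
apply: le_trans; last by apply: harmonic_block_ge_ln; rewrite ltnS ltnW.
by apply: ln_thirdT => //; rewrite ler_nat -addn2 leq_addr.
Qed.

(** The chain gives the weight with exponent n; the condition on T makes the
weight with exponent n.+1 at most twice as large, and allows the two tails to
share one lower bound. *)
Lemma upper_tail_ge_weight : T <= 2 * n.+1%:R ->
  (4 * expR T)^-1 * ((T - ln 3) ^+ n.+1 / (n.+1)`!%:R) <=
  1 - log_digit_cdf n.+1 T.
Proof.
move=> Tn; apply: (@le_trans _ _ (1 - chain_cdf R n.+1 1 K)); last first.
  by rewrite lerB// ecf_cdf_le_chain.
apply: le_trans; last by apply: chain_tail_ge_poisson; rewrite K_gt0.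
have eT := expR_gt0 T; have n0 : 0 < n.+1%:R :> R by rewrite ltr0n.
apply: (@le_trans _ _ ((2 * expR T)^-1 * ((T - ln 3) ^+ n / n`!%:R))).
  have f0 : 0 < n`!%:R :> R by rewrite ltr0n fact_gt0.
  have -> : (4 * expR T)^-1 * ((T - ln 3) ^+ n.+1 / (n.+1)`!%:R) =
      (2 * expR T)^-1 * ((T - ln 3) ^+ n / n`!%:R) *
      ((T - ln 3) / (2 * n.+1%:R)).
    rewrite exprS factS natrM; field.
    by rewrite !gt_eqF//= nat1r.
  rewrite ler_piMr//.
    by rewrite !mulr_ge0 ?invr_ge0 ?mulr_ge0 ?exprn_ge0 ?expR_ge0.
  rewrite ler_pdivrMr ?mulr_gt0// mul1r (le_trans _ Tn)// gerBl ln_ge0//; lra.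
apply: ler_pM; rewrite ?invr_ge0 ?mulr_ge0 ?divr_ge0 ?exprn_ge0 ?expR_ge0//.
  rewrite div1r lef_pV2 ?posrE ?mulr_gt0 ?ltr0n//.
  by have := K_lt; have := expT3; lra.
rewrite ler_wpM2r ?invr_ge0// lerXn2r ?nnegrE ?harmonic_block_ge0//.
apply: le_trans; last exact: harmonic_block_ge_ln.
by apply: ln_thirdT => //; rewrite ler_nat -addn1 leq_addr.
Qed.

End threshold.

Lemma poisson_weight_ge n T : ln 3 < T ->
  expR (n.+1%:R * ln ((T - ln 3) / n.+1%:R) - T + n.+1%:R -
    1 - ln 4 - ln n.+1%:R) <=
  (4 * expR T)^-1 * ((T - ln 3) ^+ n.+1 / (n.+1)`!%:R).
Proof.
move=> T3; have u0 : 0 < T - ln 3 by rewrite subr_gt0.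
have n0 : 0 < n.+1%:R :> R by rewrite ltr0n.
have f0 : 0 < (n.+1)`!%:R :> R by rewrite ltr0n fact_gt0.
rewrite -[leRHS]lnK ?posrE; last first.
  by rewrite mulr_gt0 ?divr_gt0 ?invr_gt0 ?mulr_gt0 ?exprn_gt0 ?expR_gt0.
rewrite ler_expR [leRHS]lnM ?posrE; last 2 first.
- by rewrite invr_gt0 mulr_gt0 ?expR_gt0.
- by rewrite divr_gt0 ?exprn_gt0.
rewrite lnV ?posrE ?mulr_gt0 ?expR_gt0//.
rewrite [ln (_ * expR T)]lnM ?posrE ?expR_gt0//.
rewrite expRK.
rewrite !ln_div ?posrE ?exprn_gt0// lnXn// -[ln _ *+ _]mulr_natl.
by have := ln_fact_le n; lra.
Qed.
End bounds.

Section asymptotics.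
Variable R : realType.

(** The derivative of the difference of the two sides has the sign of its
argument on the segment between 0 and u; the hypothesis is exactly what this
requires when u < 0. *)
Lemma ln1D_ge (d u : R) : 0 <= d -> 1 <= (1 + 2 * d) * (1 + u) ->
  u - (1 / 2 + d) * u ^+ 2 <= ln (1 + u).
Proof.
move=> d0 du.
pose f : R -> R := (@ln R \o (cst 1 + id)) - (id - cst (1 / 2 + d) * id ^+ 2).
pose df (x : R) := x * ((1 + 2 * d) * (1 + x) - 1) / (1 + x).
have fE x : f x = ln (1 + x) - (x - (1 / 2 + d) * x ^+ 2) by [].
have derf (x : R) : -1 < x -> is_derive x (1 : R) f (df x).
  move=> x1; have x1' : 0 < (cst 1 + id) x.
    by rewrite /= -[X in X < _](addrN 1) ltrD2l.
  have dln := is_derive1_ln x1'.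
  have d1 : is_derive x (1 : R) (cst 1 + id : R -> R) 1.
    by apply: is_derive_eq; rewrite add0r.
  apply: is_derive_eq.
  rewrite /df /GRing.scale/= mulr0 (_ : (cst 1 + id) x = 1 + x)//; field.
  by rewrite gt_eqF.
have mono (c : R) : u <= c \/ 0 <= c -> 0 <= (1 + 2 * d) * (1 + c) - 1.
  by case=> h; rewrite subr_ge0; nra.
have u1 : -1 < u.
  rewrite -subr_gt0 opprK addrC -(@pmulr_rgt0 _ (1 + 2 * d)); lra.
have cf (x : R) : -1 < x -> {for x, continuous f}.
  move=> /derf h; apply: differentiable_continuous; apply/derivable1_diffP.
  by case: h.
have f0 : f 0 = 0 by rewrite fE addr0 ln1 expr0n/= mulr0 subrr subr0.
rewrite -subr_ge0 -fE.
case: (ltgtP u 0) => [un|up|->]; last by rewrite f0.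
  have [||c] := @MVT R f df u 0 un.
  - by move=> x; rewrite in_itv/= => /andP[ux _]; apply: derf; lra.
  - apply: continuous_in_subspaceT => x; rewrite inE/= in_itv/= => /andP[ux _].
    by apply: cf; lra.
  rewrite in_itv/= => /andP[uc c0]; rewrite f0 !sub0r => fu.
  rewrite -oppr_le0 fu mulr_le0_ge0//; last lra.
  have c1 : 0 <= 1 + c by lra.
  rewrite /df -mulrA mulr_le0_ge0 ?(ltW c0)// divr_ge0// mono//.
  by left; exact: ltW.
have [||c] := @MVT R f df 0 u up.
- by move=> x; rewrite in_itv/= => /andP[ux _]; apply: derf; lra.
- apply: continuous_in_subspaceT => x; rewrite inE/= in_itv/= => /andP[ux _].
  by apply: cf; lra.
rewrite in_itv/= => /andP[c0 cu]; rewrite f0 !subr0 => ->.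
have c1 : 0 <= 1 + c by lra.
rewrite mulr_ge0 ?(ltW up)// /df -mulrA mulr_ge0 ?(ltW c0)// divr_ge0// mono//.
by right; exact: ltW.
Qed.
End asymptotics.

Section tail_estimates.
Variable R : realType.
Variables (n : nat) (A y d : R).
Hypotheses (n0 : (0 < n)%N) (A0 : 0 < A) (d0 : 0 <= d).
Let T := n%:R + y * A.
Let nR : 0 < n%:R :> R. Proof. by rewrite ltr0n. Qed.

Let expR_ln_exprN (x : R) : 0 < x -> x ^- n = expR (- (n%:R * ln x)).
Proof. by move=> x0; rewrite expRN mulrC expRM_natr lnK. Qed.

Section chernoff.
Hypotheses (yA : `|y| * A / n%:R <= 1 / 2)
  (dyA : 1 <= (1 + 2 * d) * (1 - `|y| * A / n%:R)).

(** The Laplace bound at t = |y| A / n, the minimiser of t^2 n / 2 - t |y| A. *)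
Lemma upper_chernoff : 0 < y ->
  1 - log_digit_cdf n T <=
  2 * expR (- ((1 / 2 - d) * y ^+ 2 * (n%:R^-1 * A ^+ 2))).
Proof.
move=> y0; move: yA dyA; rewrite gtr0_norm//; set t := y * A / n%:R => t2 dt.
have t0 : 0 <= t by rewrite divr_ge0 ?mulr_ge0 ?ltW.
have t1 : t < 1 by lra.
apply: le_trans (upper_tail_laplace n T t0 t1) _.
rewrite -mulrA ler_wpM2l// expR_ln_exprN ?subr_gt0// -expRD ler_expR.
have := ln1D_ge d0 dt; rewrite sqrrN -(ler_pM2l nR).
have tn : t * n%:R = y * A by rewrite divfK ?gt_eqF.
have -> : (1 / 2 - d) * y ^+ 2 * (n%:R^-1 * A ^+ 2) =
    (1 / 2 - d) * n%:R * t ^+ 2.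
  by rewrite /t; field; rewrite gt_eqF.
rewrite /T -tn; lra.
Qed.

Lemma lower_chernoff : y < 0 ->
  log_digit_cdf n T <=
  2 * expR (- ((1 / 2 - d) * y ^+ 2 * (n%:R^-1 * A ^+ 2))).
Proof.
move=> y0; move: yA dyA; rewrite ltr0_norm//; set t := - y * A / n%:R => t2 dt.
have t0 : 0 <= t by rewrite divr_ge0 ?mulr_ge0 ?oppr_ge0 ?ltW.
have t1 : t < 1 by lra.
apply: le_trans (lower_tail_laplace n T t0 t1) _.
have p0 : 0 <= (1 + t) ^- n by rewrite invr_ge0 exprn_ge0//; lra.
rewrite -mulrA ler_pM ?invr_ge0 ?subr_ge0 ?(ltW t1) ?mulr_ge0 ?expR_ge0//.
  by rewrite -[leRHS]invrK lef_pV2 ?posrE ?subr_gt0// -div1r; lra.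
rewrite expR_ln_exprN -?expRD ?ler_expR; last lra.
have dt' : 1 <= (1 + 2 * d) * (1 + t) by nra.
have := ln1D_ge d0 dt'; rewrite -(ler_pM2l nR).
have tn : t * n%:R = - y * A by rewrite divfK ?gt_eqF.
have -> : (1 / 2 - d) * y ^+ 2 * (n%:R^-1 * A ^+ 2) =
    (1 / 2 - d) * n%:R * t ^+ 2.
  by rewrite /t; field; rewrite gt_eqF.
have -> : T = n%:R - t * n%:R by rewrite /T tn; ring.
lra.
Qed.

End chernoff.

(** What the lower bounds lose besides ln n: the constants of Stirling's bound
and of the Poisson weight, and the terms that ln 3 adds to the square of
y A. *)
Definition tail_loss (z : R) : R :=
  1 + ln 3 + ln 4 + 2 * `|z| * ln 3 + ln 3 ^+ 2.

Hypotheses (d2 : d <= 1 / 2) (An : A <= n%:R) (yAn : `|y| * A <= n%:R)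
  (T3 : ln 3 < T) (du : 1 <= (1 + 2 * d) * (1 + (y * A - ln 3) / n%:R)).

(** With u = (y A - ln 3) / n the logarithm is ln (1 + u), and its first-order
term cancels the linear terms in T and n. *)
Let exponent_ge :
  - ((1 / 2 + d) * y ^+ 2 * (n%:R^-1 * A ^+ 2) + tail_loss y + ln n%:R) <=
  n%:R * ln ((T - ln 3) / n%:R) - T + n%:R - 1 - ln 4 - ln n%:R.
Proof.
move: T3 du; set l := ln 3; set u := (y * A - l) / n%:R => lT du'.
have l0 : 0 <= l by rewrite ln_ge0//; lra.
have -> : (T - l) / n%:R = 1 + u.
  by rewrite /T /u; field; rewrite gt_eqF.
have := ln1D_ge d0 du'; rewrite -(ler_pM2l nR) mulrBr.
have -> : n%:R * u = y * A - l by rewrite mulrC divfK ?gt_eqF.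
have nu2 : n%:R * u ^+ 2 <=
    y ^+ 2 * (n%:R^-1 * A ^+ 2) + 2 * `|y| * l + l ^+ 2.
  rewrite [leLHS](_ : _ = y ^+ 2 * (n%:R^-1 * A ^+ 2) +
      (- (2 * y * l) * (A / n%:R) + l ^+ 2 / n%:R)); last first.
    by rewrite /u; field; rewrite gt_eqF.
  rewrite -addrA lerD2l lerD//.
    have AnR : A / n%:R <= 1 by rewrite ler_pdivrMr// mul1r.
    have An0 : 0 <= A / n%:R by rewrite divr_ge0// ltW.
    apply: (@le_trans _ _ (2 * `|y| * l * (A / n%:R))).
      rewrite ler_wpM2r// -mulNr ler_wpM2r// -mulrN ler_wpM2l//.
      by rewrite -normrN ler_norm.
    by rewrite ler_piMr// !mulr_ge0.
  by rewrite ler_pdivrMr// ler_peMr ?sqr_ge0// ler1n.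
have Z0 : 0 <= 2 * `|y| * l + l ^+ 2 by rewrite addr_ge0 ?sqr_ge0 ?mulr_ge0.
have d1 : 0 <= 1 / 2 + d by rewrite addr_ge0.
have := ler_wpM2l d1 nu2.
have d3 : 1 / 2 + d <= 1 by have := d2; lra.
have := ler_wpM2r Z0 d3.
rewrite /tail_loss -/l /T; lra.
Qed.

Lemma lower_poisson :
  expR (- ((1 / 2 + d) * y ^+ 2 * (n%:R^-1 * A ^+ 2) + tail_loss y + ln n%:R))
  <= log_digit_cdf n T.
Proof.
apply: (@le_trans _ _ (expR _)); first by rewrite ler_expR; exact: exponent_ge.
apply: le_trans (lower_tail_ge_weight n (ltW T3)).
by rewrite -(prednK n0); apply: poisson_weight_ge.
Qed.

Lemma upper_poisson :
  expR (- ((1 / 2 + d) * y ^+ 2 * (n%:R^-1 * A ^+ 2) + tail_loss y + ln n%:R))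
  <= 1 - log_digit_cdf n T.
Proof.
apply: (@le_trans _ _ (expR _)); first by rewrite ler_expR; exact: exponent_ge.
rewrite -(prednK n0); apply: le_trans (upper_tail_ge_weight (ltW T3) _).
  exact: poisson_weight_ge.
rewrite prednK// /T.
have : y * A <= `|y| * A by rewrite ler_wpM2r ?ler_norm// ltW.
by have := yAn; lra.
Qed.
End tail_estimates.

(** * From tail asymptotics to the moderate deviation principle *)

Section mdp.
Variable R : realType.

Lemma ereal_eqNy (x : \bar R) : (forall c : R, x <= (- c)%:E)%E -> x = -oo%E.
Proof.
case: x => [r| |] // H; last by have := H 0.
by have := H (1 - r); rewrite lee_fin {H} => h; exfalso; lra.
Qed.

Lemma good_rate_sqr : good_rate_function (fun x : R => (x ^+ 2 / 2)%:E).
Proof.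
split.
- by move=> x; rewrite lee_fin divr_ge0// sqr_ge0.
- apply/lower_semicontinuousP => c.
  rewrite (_ : mkset _ = (fun x : R => x ^+ 2 / 2) @^-1` `]c, +oo[).
    apply: open_comp => [x _|]; last exact: interval_open.
    apply: cvgM; last exact: cvg_cst.
    exact: exprn_continuous.
  by apply/seteqP; split => x; rewrite /= in_itv/= andbT lte_fin.
- move=> c; have [c0|c0] := ltP c 0.
    rewrite (_ : mkset _ = set0); first exact: compact0.
    apply/seteqP; split => // x /=; rewrite lee_fin => xc.
    by have := sqr_ge0 x; lra.
  rewrite (_ : mkset _ = `[- Num.sqrt (2 * c), Num.sqrt (2 * c)]%classic).
    exact: segment_compact.
  apply/seteqP; split => x; rewrite /= in_itv/= lee_fin -ler_norml.
    by rewrite -sqrtr_sqr => h; rewrite ler_wsqrtr//; lra.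
  rewrite -sqrtr_sqr ler_sqrt ?mulr_ge0//; lra.
Qed.

Lemma limn_esup_le (u : (\bar R)^nat) (l : \bar R) :
  (\forall n \near \oo, u n <= l)%E -> (limn_esup u <= l)%E.
Proof.
move=> ul; apply: le_trans (ereal_inf_lbound _) _.
  by exists [set n | (u n <= l)%E].
by apply: ge_ereal_sup => _ [n un <-].
Qed.

Lemma limn_einf_ge (u : (\bar R)^nat) (l : \bar R) :
  (\forall n \near \oo, l <= u n)%E -> (l <= limn_einf u)%E.
Proof.
move=> lu; rewrite /limn_einf leeNr; apply: limn_esup_le.
by near=> n; rewrite leeN2; near: n.
Unshelve. all: by end_near. Qed.

Lemma rate_le (s c : R) (p : \bar R) : 0 < s -> (0 <= p)%E ->
  (p <= (expR (s * c))%:E)%E -> ((s^-1)%:E * lne p <= c%:E)%E.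
Proof.
move=> s0 p0 pc; rewrite -[c](mulKf (lt0r_neq0 s0)) EFinM.
rewrite lee_pmul2l ?lte_fin ?invr_gt0//.
rewrite -[(s * c)%:E]expeRK lee_lne ?in_itv/= ?leey ?p0//.
by rewrite lee_fin expR_ge0.
Qed.

Lemma rate_ge (s c : R) (p : \bar R) : 0 < s ->
  ((expR (s * c))%:E <= p)%E -> (c%:E <= (s^-1)%:E * lne p)%E.
Proof.
move=> s0 pc; rewrite -[c](mulKf (lt0r_neq0 s0)) EFinM.
rewrite lee_pmul2l ?lte_fin ?invr_gt0//.
have p0 : (0 <= p)%E by apply: le_trans pc; rewrite lee_fin expR_ge0.
rewrite -[(s * c)%:E]expeRK lee_lne ?in_itv/= ?leey ?p0//.
by rewrite lee_fin expR_ge0.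
Qed.

Lemma expR_sub_half (A B : R) : A + ln 2 <= B ->
  expR (- A - ln 2) <= expR (- A) - expR (- B).
Proof.
move=> AB; rewrite expRD [expR (- ln 2)]expRN lnK ?posrE//.
have : expR (- B) <= expR (- A - ln 2) by rewrite ler_expR; lra.
by rewrite expRD [expR (- ln 2)]expRN lnK ?posrE//; lra.
Qed.

Section tails.
Context d (T : measurableType d) (P : probability T R).
Variables (X : nat -> {RV P >-> R}) (s : nat -> R) (F : nat -> R -> R).
Hypothesis s_oo : s n @[n --> \oo] --> +oo.
Hypothesis FE : \forall n \near \oo, forall y,
  P (X n @^-1` `]-oo, y[) = (F n y)%:E.
Hypothesis lower_ge : forall y e : R, 0 < e -> \forall n \near \oo,
  expR (- (s n * (y ^+ 2 / 2 + e))) <= F n y.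
Hypothesis upper_ge : forall y e : R, 0 < e -> \forall n \near \oo,
  expR (- (s n * (y ^+ 2 / 2 + e))) <= 1 - F n y.
Hypothesis lower_le : forall y e : R, y < 0 -> 0 < e -> \forall n \near \oo,
  F n y <= expR (- (s n * (y ^+ 2 / 2 - e))).
Hypothesis upper_le : forall y e : R, 0 < y -> 0 < e -> \forall n \near \oo,
  1 - F n y <= expR (- (s n * (y ^+ 2 / 2 - e))).

Let s_ge (A : R) : \forall n \near \oo, A <= s n.
Proof. by move/cvgryPge : s_oo; apply. Qed.

Let mX n (A : set R) : measurable A -> measurable (X n @^-1` A).
Proof.
by move=> mA; rewrite -[X in measurable X]setTI; exact: measurable_funP.
Qed.

Let upperE n y : P (X n @^-1` `]-oo, y[) = (F n y)%:E ->
  P (X n @^-1` `[y, +oo[) = (1 - F n y)%:E.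
Proof.
move=> E; rewrite EFinB -E -probability_setC; last exact: mX.
congr (P _); apply/seteqP; split => x /=.
  by rewrite !in_itv/= andbT leNgt => /negP.
by rewrite !in_itv/= andbT leNgt => /negP.
Qed.

(** If c is below the infimum of the rate, the set lies in the union of the two
half-lines where x^2 / 2 > c. *)
Let ldp_upper (G : set R) : measurable G ->
  (limn_esup (fun n => (s n)^-1%:E * lne (P (X n @^-1` G))) <=
  - ereal_inf ((fun x : R => (x ^+ 2 / 2)%:E) @` closure G))%E.
Proof.
move=> mG; rewrite leeNr; set I := ereal_inf _; set L := limn_esup _.
suff H (c : R) : (c%:E < I)%E -> (L <= (- c)%:E)%E.
  case: I H => [r| |] H; last by rewrite leNye.
    rewrite leeNr; apply/lee_addgt0Pr => e e0; rewrite -EFinN -EFinD.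
    by rewrite (_ : - r + e = - (r - e)); [apply: H; rewrite lte_fin; lra|ring].
  by rewrite (_ : L = -oo%E)//; apply: ereal_eqNy => c; apply: H; rewrite ltry.
move=> cI; have Gc x : G x -> c < x ^+ 2 / 2.
  move=> Gx; rewrite -lte_fin; apply: lt_le_trans cI _.
  by apply: ereal_inf_lbound; exists x => //; exact: subset_closure.
have [c0|c0] := leP c 0.
  apply: limn_esup_le; near=> n.
  have sn : 0 < s n by apply: lt_le_trans ltr01 _; near: n; exact: s_ge.
  apply: rate_le => //; apply: le_trans (probability_le1 _ (mX _ mG)) _.
  by rewrite lee_fin -expR0 ler_expR mulr_ge0 ?(ltW sn)// oppr_ge0.
apply/lee_addgt0Pr => e e0; apply: limn_esup_le.
pose y := Num.sqrt (2 * c).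
have y0 : 0 < y by rewrite sqrtr_gt0; lra.
have y2 : y ^+ 2 = 2 * c by rewrite sqr_sqrtr//; lra.
have e20 : 0 < e / 2 by rewrite divr_gt0.
near=> n.
have sn : 0 < s n by apply: lt_le_trans ltr01 _; near: n; exact: s_ge.
have sne : 2 * ln 2 / e <= s n by near: n; exact: s_ge.
have En : P (X n @^-1` `]-oo, - y[) = (F n (- y))%:E.
  by move: (- y); near: n.
have En' : P (X n @^-1` `]-oo, y[) = (F n y)%:E by move: (y); near: n.
rewrite -EFinD; apply: rate_le => //.
apply: (@le_trans _ _ (P (X n @^-1` `]-oo, - y[ `|` X n @^-1` `[y, +oo[))).
  apply: le_measure; rewrite ?inE; first exact: mX.
    by apply: measurableU; exact: mX.
  move=> w /Gc; rewrite /= !in_itv/= andbT; move: (X n w) => x cx.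
  have [xy|yx] := ltP x (- y); [by left|right]; rewrite leNgt; apply/negP => xy.
  have : 0 <= (y - x) * (x + y) by apply: mulr_ge0; lra.
  lra.
apply: le_trans (measureU2 _ _ _) _; [exact: mX|exact: mX|].
rewrite [X in (_ + X <= _)%E](upperE En') [X in (X + _ <= _)%E]En.
rewrite -EFinD lee_fin.
have h1 : F n (- y) <= expR (- (s n * ((- y) ^+ 2 / 2 - e / 2))).
  by near: n; apply: (lower_le _ e20); rewrite oppr_lt0.
have h2 : 1 - F n y <= expR (- (s n * (y ^+ 2 / 2 - e / 2))).
  by near: n; exact: (upper_le y0 e20).
move: h1 h2; rewrite sqrrN y2 => h1 h2.
apply: (@le_trans _ _ (2 * expR (- (s n * (2 * c / 2 - e / 2))))); first lra.
rewrite -{1}[2]lnK ?posrE// -expRD ler_expR.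
have : ln 2 <= s n * (e / 2) by move: sne; rewrite ler_pdivrMr//; lra.
lra.
Unshelve. all: by end_near. Qed.

(** An interval [y 1, y 2) beyond x, on the side away from 0, carries at least
the difference of two tails, and the farther tail is negligible. *)
Let ldp_lower_at (G : set R) (x : R) : measurable G -> G° x ->
  ((- (x ^+ 2 / 2))%:E <=
   limn_einf (fun n => (s n)^-1%:E * lne (P (X n @^-1` G))))%E.
Proof.
move=> mG; rewrite /interior /= => /nbhs_ballP[r /= r0 xrG].
have inG z : `|z - x| < r -> G z.
  by move=> zx; apply: xrG; rewrite /ball/= distrC.
apply/lee_subgt0Pr => e e0; rewrite -EFinB.
(* h is small against the radius r, so that y 2 stays in the set, and against e,
   so that the rate at y 1 exceeds the rate at x by less than e *)
pose h := Num.min (r / 4) (Num.min 1 (e / (2 * `|x| + 2) / 2)).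
have x0 := normr_ge0 x.
have h0 : 0 < h by rewrite !lt_min ltr01 !divr_gt0//; lra.
have hr : h <= r / 4 by rewrite /h ge_min lexx.
have h1 : h <= 1 by rewrite /h !ge_min lexx orbT.
have he : h * (2 * `|x| + 2) <= e / 2.
  rewrite -ler_pdivlMr; last lra.
  by rewrite /h mulrAC !ge_min lexx !orbT.
pose sg : R := if 0 <= x then 1 else -1.
have sg2 : sg ^+ 2 = 1.
  by rewrite /sg; case: ifP; rewrite ?expr1n// sqrrN expr1n.
pose y k := sg * (`|x| + k * h).
have y2 k : y k ^+ 2 = (`|x| + k * h) ^+ 2 by rewrite exprMn sg2 mul1r.
pose A := y 1 ^+ 2 / 2 + h ^+ 2 / 4.
pose B := y 2 ^+ 2 / 2 - h ^+ 2 / 4.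
have hh : 0 < h ^+ 2 / 4 by rewrite divr_gt0// exprn_gt0.
have AB : A + h ^+ 2 <= B.
  rewrite /A /B !y2; have := mulr_ge0 x0 (ltW h0); nra.
have Ae : A + h ^+ 2 / 4 <= x ^+ 2 / 2 + e.
  rewrite /A y2 -[x ^+ 2]real_normK ?num_real//.
  have : h ^+ 2 <= h by rewrite expr2 ler_piMl// ltW.
  nra.
suff diff : \forall n \near \oo,
    ((expR (- (s n * A)) - expR (- (s n * B)))%:E <= P (X n @^-1` G))%E.
  apply: limn_einf_ge; near=> n.
  have sn : 0 < s n by apply: lt_le_trans ltr01 _; near: n; exact: s_ge.
  have snh : ln 2 / (h ^+ 2 / 4) <= s n by near: n; exact: s_ge.
  apply: rate_ge => //; apply: (@le_trans _ _
    (expR (- (s n * A)) - expR (- (s n * B)))%:E); last by near: n.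
  have lnh : ln 2 <= s n * (h ^+ 2 / 4) by rewrite -ler_pdivrMr.
  rewrite lee_fin.
  apply: le_trans (expR_sub_half _); last first.
    have := ler_wpM2l (ltW sn) AB; have := mulr_ge0 (ltW sn) (ltW hh).
    by rewrite !mulrDr; lra.
  by rewrite ler_expR; have := ler_wpM2l (ltW sn) Ae; lra.
have [xp|xn] := leP 0 x.
  have ye k : y k = x + k * h by rewrite /y /sg xp mul1r ger0_norm.
  have y20 : 0 < y 2 by rewrite ye; lra.
  near=> n.
  have E1 : P (X n @^-1` `]-oo, y 1[) = (F n (y 1))%:E by move: (y 1); near: n.
  have E2 : P (X n @^-1` `]-oo, y 2[) = (F n (y 2))%:E by move: (y 2); near: n.
  have pA : expR (- (s n * A)) <= 1 - F n (y 1) by near: n; exact: upper_ge.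
  have pB : 1 - F n (y 2) <= expR (- (s n * B)) by near: n; exact: upper_le.
  have : (P (X n @^-1` `[y 1%R, +oo[) <=
      P (X n @^-1` `[y 2%R, +oo[) + P (X n @^-1` G))%E.
    apply: le_trans (measureU2 _ _ _); [|exact: mX|exact: mX].
    apply: le_measure; rewrite ?inE; first exact: mX.
      by apply: measurableU; exact: mX.
    move=> w; rewrite /= !in_itv/= !andbT; move: (X n w) => z yz.
    have [y2z|zy2] := leP (y 2) z; [by left|right; apply: inG].
    by rewrite ltr_norml; move: zy2 yz; rewrite !ye; lra.
  rewrite (upperE E1) [X in (_ <= X + _)%E](upperE E2) -leeBlDl// -EFinB.
  by apply: le_trans; rewrite lee_fin; lra.
have ye k : y k = x - k * h.
  by rewrite /y /sg leNgt xn/= ltr0_norm//; ring.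
have y20 : y 2 < 0 by rewrite ye; lra.
near=> n.
have E1 : P (X n @^-1` `]-oo, y 1[) = (F n (y 1))%:E by move: (y 1); near: n.
have E2 : P (X n @^-1` `]-oo, y 2[) = (F n (y 2))%:E by move: (y 2); near: n.
have pA : expR (- (s n * A)) <= F n (y 1) by near: n; exact: lower_ge.
have pB : F n (y 2) <= expR (- (s n * B)) by near: n; exact: lower_le.
have : (P (X n @^-1` `]-oo, y 1%R[) <=
    P (X n @^-1` `]-oo, y 2%R[) + P (X n @^-1` G))%E.
  apply: le_trans (measureU2 _ _ _); [|exact: mX|exact: mX].
  apply: le_measure; rewrite ?inE; first exact: mX.
    by apply: measurableU; exact: mX.
  move=> w; rewrite /= !in_itv/=; move: (X n w) => z zy1.
  have [zy2|y2z] := ltP z (y 2); [by left|right; apply: inG].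
  by rewrite ltr_norml; move: zy1 y2z; rewrite !ye; lra.
rewrite E1 [X in (_ <= X + _)%E]E2 -leeBlDl// -EFinB.
by apply: le_trans; rewrite lee_fin; lra.
Unshelve. all: by end_near. Qed.

(** The upper bounds are only meaningful on the side of 0 where the event is
rare, whereas the lower bounds hold at every level. *)
Lemma mdp_of_tails :
  moderate_deviation_principle X s (fun x : R => (x ^+ 2 / 2)%:E).
Proof.
split=> // [|G mG rate]; first exact: good_rate_sqr.
split; [|exact: limn_einf_sup|exact: ldp_upper].
rewrite leeNl; apply: le_ereal_inf_tmp => _ [x Gx <-].
by rewrite leeNl -EFinN; exact: ldp_lower_at.
Qed.

End tails.
End mdp.

(** * Tails of the logarithm of a digit at the moderate scale *)

Section moderate_tails.
Variables (R : realType) (a : nat -> R).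
Hypotheses (a_gt0 : forall n : nat, (1 <= n)%N -> 0 < a n)
  (a_lower : a n / Num.sqrt (n%:R * ln n%:R) @[n --> \oo] --> +oo)
  (a_upper : a n / n%:R @[n --> \oo] --> (0 : R)).
Let s n : R := n%:R^-1 * a n ^+ 2.

(** The logarithmic loss in the lower bounds is negligible: this is what the
growth of a n / sqrt (n ln n) provides. *)
Lemma speed_ge_ln (c : R) : \forall n \near \oo, c * ln n%:R <= s n.
Proof.
near=> n; have n2 : (1 < n)%N by near: n; exact: nbhs_infty_gt.
have nR : 0 < n%:R :> R by rewrite ltr0n ltnW.
have ln0 : 0 < ln n%:R :> R by rewrite ln_gt0// ltr1n.
have c1 : 1 <= Num.max 1 c by rewrite le_max lexx.
have : Num.max 1 c <= a n / Num.sqrt (n%:R * ln n%:R).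
  by near: n; move/cvgryPge : a_lower; apply.
have nl : 0 < n%:R * ln n%:R :> R by rewrite mulr_gt0.
rewrite ler_pdivlMr ?sqrtr_gt0// => h.
have : (Num.max 1 c * Num.sqrt (n%:R * ln n%:R)) ^+ 2 <= a n ^+ 2.
  have an := ltW (a_gt0 (ltnW n2)).
  by rewrite lerXn2r ?nnegrE ?mulr_ge0 ?sqrtr_ge0//; lra.
rewrite exprMn sqr_sqrtr ?(ltW nl)// => h2.
rewrite /s [leRHS]mulrC ler_pdivlMr// (le_trans _ h2)// -mulrA [ln _ * _]mulrC.
rewrite ler_wpM2r ?(ltW nl)//.
apply: (@le_trans _ _ (Num.max 1 c)); first by rewrite le_max lexx orbT.
by rewrite expr2 ler_peMl//; lra.
Unshelve. all: by end_near. Qed.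

Lemma speed_ge (c : R) : \forall n \near \oo, c <= s n.
Proof.
near=> n; have n2 : (1 < n)%N by near: n; exact: nbhs_infty_gt.
have l2 : 0 < ln 2 :> R by rewrite ln_gt0// ltr1n.
have c0 : c <= `|c| by exact: ler_norm.
apply: (@le_trans _ _ (`|c| / ln 2 * ln n%:R)); last first.
  by near: n; exact: speed_ge_ln.
rewrite (le_trans c0)// mulrAC ler_pdivlMr// ler_wpM2l//.
by rewrite ler_ln ?posrE ?ltr0n ?(ltnW n2)// ler_nat.
Unshelve. all: by end_near. Qed.

Lemma scale_le (e : R) : 0 < e -> \forall n \near \oo, a n <= e * n%:R.
Proof.
move=> e0; near=> n; have n0 : (0 < n)%N by near: n; exact: nbhs_infty_gt.
rewrite -ler_pdivrMr ?ltr0n//; apply: le_trans (ler_norm _) _.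
by near: n; move/cvgr0Pnorm_le : a_upper; apply.
Unshelve. all: by end_near. Qed.

Section fixed_level.
Variables (y e : R).
Hypothesis e0 : 0 < e.
(** The error allowed in the second-order expansion of the logarithm, small
enough for d * y^2 to use only half of e. *)
Let d : R := Num.min (1 / 2) (e / (2 * (y ^+ 2 + 1))).

Let y1_gt0 : 0 < y ^+ 2 + 1. Proof. by rewrite ltr_wpDl ?sqr_ge0. Qed.

Let d_gt0 : 0 < d.
Proof. by rewrite lt_min !divr_gt0// mulr_gt0. Qed.

Let d_le : d <= 1 / 2. Proof. by rewrite ge_min lexx. Qed.

Let dy_le : d * y ^+ 2 <= e / 2.
Proof.
have : d * (2 * (y ^+ 2 + 1)) <= e.
  by rewrite -ler_pdivlMr ?mulr_gt0// ge_min lexx orbT.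
by have := d_gt0; lra.
Qed.

Let scale_small : \forall n \near \oo,
  [/\ (0 < n)%N, 0 < a n, `|y| * a n / n%:R <= d / 4 & ln 3 / n%:R <= d / 4].
Proof.
have y0 := normr_ge0 y.
have d4 : 0 < d / 4 by rewrite divr_gt0.
near=> n; have n0 : (0 < n)%N by near: n; exact: nbhs_infty_gt.
have nR : 0 < n%:R :> R by rewrite ltr0n.
have an := a_gt0 n0; split => //.
- have : a n <= d / 4 / (`|y| + 1) * n%:R.
    by near: n; apply: scale_le; rewrite divr_gt0// ltr_wpDl.
  rewrite mulrAC ler_pdivlMr ?ltr_wpDl// ler_pdivrMr//; lra.
- rewrite ler_pdivrMr// -ler_pdivrMl//.
  by near: n; exact: nbhs_infty_ger.
Unshelve. all: by end_near. Qed.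

Let twice_expR_le : \forall n \near \oo,
  2 * expR (- ((1 / 2 - d) * y ^+ 2 * s n)) <=
  expR (- (s n * (y ^+ 2 / 2 - e))).
Proof.
near=> n.
have : 2 * ln 2 / e <= s n by near: n; exact: speed_ge.
have : 0 <= s n by near: n; exact: speed_ge.
rewrite ler_pdivrMr// => s0 se.
rewrite -[X in X * _]lnK ?posrE// -expRD ler_expR.
by have := ler_wpM2l s0 dy_le; lra.
Unshelve. all: by end_near. Qed.

Let loss_le : \forall n \near \oo,
  expR (- (s n * (y ^+ 2 / 2 + e))) <=
  expR (- ((1 / 2 + d) * y ^+ 2 * s n + tail_loss y + ln n%:R)).
Proof.
near=> n.
have : 4 * tail_loss y / e <= s n by near: n; exact: speed_ge.
have : 4 / e * ln n%:R <= s n by near: n; exact: speed_ge_ln.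
have : 0 <= s n by near: n; exact: speed_ge.
rewrite mulrAC !ler_pdivrMr// => s0 h1 h2.
by rewrite ler_expR; have := ler_wpM2l s0 dy_le; lra.
Unshelve. all: by end_near. Qed.

Lemma moderate_upper_tail_le : 0 < y -> \forall n \near \oo,
  1 - log_digit_cdf n (n%:R + y * a n) <= expR (- (s n * (y ^+ 2 / 2 - e))).
Proof.
move=> y0; near=> n.
have [n0 an ya _] : [/\ (0 < n)%N, 0 < a n, `|y| * a n / n%:R <= d / 4 &
  ln 3 / n%:R <= d / 4] by near: n; exact: scale_small.
apply: (@le_trans _ _ (2 * expR (- ((1 / 2 - d) * y ^+ 2 * s n)))); last first.
  by near: n; exact: twice_expR_le.
have := d_le; have := d_gt0 => dp dl.
apply: upper_chernoff => //; [exact: ltW|lra|nra].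
Unshelve. all: by end_near. Qed.

Lemma moderate_lower_tail_le : y < 0 -> \forall n \near \oo,
  log_digit_cdf n (n%:R + y * a n) <= expR (- (s n * (y ^+ 2 / 2 - e))).
Proof.
move=> y0; near=> n.
have [n0 an ya _] : [/\ (0 < n)%N, 0 < a n, `|y| * a n / n%:R <= d / 4 &
  ln 3 / n%:R <= d / 4] by near: n; exact: scale_small.
apply: (@le_trans _ _ (2 * expR (- ((1 / 2 - d) * y ^+ 2 * s n)))); last first.
  by near: n; exact: twice_expR_le.
have := d_le; have := d_gt0 => dp dl.
apply: lower_chernoff => //; [exact: ltW|lra|nra].
Unshelve. all: by end_near. Qed.

Let poisson_conditions n : (0 < n)%N -> 0 < a n ->
    `|y| * a n / n%:R <= d / 4 -> ln 3 / n%:R <= d / 4 -> a n <= n%:R ->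
  [/\ `|y| * a n <= n%:R, ln 3 < n%:R + y * a n &
      1 <= (1 + 2 * d) * (1 + (y * a n - ln 3) / n%:R)].
Proof.
move=> n0 an ya l3 aN; have nR : 0 < n%:R :> R by rewrite ltr0n.
have := d_le; have := d_gt0 => dp dl.
have yan : - (`|y| * a n) <= y * a n.
  by rewrite -mulNr ler_wpM2r ?(ltW an)// lerNl -normrN ler_norm.
move: (ya) (l3); rewrite !ler_pdivrMr// => ya' l3'.
have u4 : - (d / 2) <= (y * a n - ln 3) / n%:R by rewrite ler_pdivlMr//; lra.
split; [nra|nra|nra].
Qed.

Lemma moderate_lower_tail_ge : \forall n \near \oo,
  expR (- (s n * (y ^+ 2 / 2 + e))) <= log_digit_cdf n (n%:R + y * a n).
Proof.
near=> n.
have [n0 an ya l3] : [/\ (0 < n)%N, 0 < a n, `|y| * a n / n%:R <= d / 4 &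
  ln 3 / n%:R <= d / 4] by near: n; exact: scale_small.
have aN : a n <= n%:R by rewrite -[n%:R]mul1r; near: n; exact: scale_le.
have [h1 h2 h3] := poisson_conditions n0 an ya l3 aN.
apply: le_trans (lower_poisson n0 an (ltW d_gt0) d_le aN h2 h3).
by near: n; exact: loss_le.
Unshelve. all: by end_near. Qed.

Lemma moderate_upper_tail_ge : \forall n \near \oo,
  expR (- (s n * (y ^+ 2 / 2 + e))) <= 1 - log_digit_cdf n (n%:R + y * a n).
Proof.
near=> n.
have [n0 an ya l3] : [/\ (0 < n)%N, 0 < a n, `|y| * a n / n%:R <= d / 4 &
  ln 3 / n%:R <= d / 4] by near: n; exact: scale_small.
have aN : a n <= n%:R by rewrite -[n%:R]mul1r; near: n; exact: scale_le.
have [h1 h2 h3] := poisson_conditions n0 an ya l3 aN.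
apply: le_trans (upper_poisson n0 an (ltW d_gt0) d_le aN h1 h2 h3).
by near: n; exact: loss_le.
Unshelve. all: by end_near. Qed.

End fixed_level.
End moderate_tails.

Theorem theorem2p2 (R : realType) (a : nat -> R)
    (a_gt0 : forall n : nat, (1 <= n)%N -> 0 < a n)
    (a_oo : a n @[n --> \oo] --> +oo)
    (a_lower : a n / Num.sqrt (n%:R * ln n%:R) @[n --> \oo] --> +oo)
    (a_upper : a n / n%:R @[n --> \oo] --> (0 : R)) :
  moderate_deviation_principle
    (P := unit_prob R)
    (fun n => ecf_log_deviation a n)
    (fun n => n%:R^-1 * a n ^+ 2)
    (fun x : R => (x ^+ 2 / 2)%:E).
Proof.
apply: (@mdp_of_tails _ _ _ _ _ _
  (fun n y => log_digit_cdf n (n%:R + y * a n))).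
- by apply/cvgryPge => c; exact: speed_ge.
- near=> n => y; apply: prob_deviation_lt; last apply: a_gt0.
    by near: n; exact: nbhs_infty_gt.
  by near: n; exact: nbhs_infty_gt.
- by move=> y e e0; exact: moderate_lower_tail_ge.
- by move=> y e e0; exact: moderate_upper_tail_ge.
- by move=> y e y0 e0; exact: moderate_lower_tail_le.
- by move=> y e y0 e0; exact: moderate_upper_tail_le.
Unshelve. all: by end_near. Qed.
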